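(* Let $(\mathcal U_1,U_1,V_1)$ and $(\mathcal U_2,U_2,V_2)$ be metric $f$-structures. Let $\phi\colon\mathcal U_1\to\mathcal U_2$ be a homomorphism of metric $f$-structures. Let $\mathscr M$ be a $V_1$-normed $U_1$-module. Then there exists a unique couple $(\phi_*\mathscr M,\phi_* )$, where $\phi_*\mathscr M$ is a $V_2$-Banach $U_2$-module and $\phi_*\colon\mathscr M\to\phi_*\mathscr M$ is linear, such that: (i) $|\phi_*v|=\phi(|v|)$ for every $v\in\mathscr M$; (ii) $\mathscr G(\phi_*(\mathscr M))$ is dense in $\phi_*\mathscr M$. Uniqueness is up to unique isomorphism: given another couple $(\mathscr N,T)$ with the same properties, there exists a unique isomorphism of $V_2$-Banach $U_2$-modules $\Phi\colon\phi_*\mathscr M\to\mathscr N$ such that $\Phi\circ\phi_*=T$.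
   Context: Riesz spaces and $f$-algebras. $\mathbb R^+=[0,\infty)$. A Riesz space is a real vector space $U$ with a partial order that is a lattice and satisfies $u\le v\Rightarrow u+w\le v+w$ and ($u\ge 0$, $\lambda\in\mathbb R^+$) $\Rightarrow\lambda u\ge 0$; $\vee,\wedge$ denote sup and inf of two elements, $u^{+}=u\vee 0$, $u^-=(-u)\vee 0$, $|u|=u\vee(-u)$, $U^+=\{u\in U:u\ge 0\}$. A Riesz subspace is a linear subspace closed under $\vee,\wedge$; a Riesz subspace $V\subset U$ is solid if $v\in U$, $u\in V$, $|v|\le|u|$ imply $v\in V$. A homomorphism of Riesz spaces is a linear map $\phi$ with $\phi(u)\wedge\phi(v)=0$ whenever $u\wedge v=0$. A family is disjoint if $|u|\wedge|v|=0$ for any two different members. Dedekind $\sigma$-complete: every countable non-empty subset bounded above has a supremum and every countable non-empty subset bounded below has an infimum. An $f$-algebra is a Riesz space with an associative, commutative, $\mathbb R$-bilinear multiplication with unit $\mathbf 1_U$ such that $uv\ge0$ for $u,v\ge 0$, and $(uw)\wedge v=0$ whenever $u\wedge v=0$ and $w\ge 0$. An $f$-subalgebra is a Riesz subspace closed under multiplication and containing $\mathbf 1_U$. A homomorphism of $f$-algebras is a multiplicative, unit-preserving homomorphism of Riesz spaces. $\mathrm{Idem}(U)=\{u\in U:u^2=u\}$. A finite partition of $u\in\mathrm{Idem}(U)$ is a finite disjoint family in $\mathrm{Idem}(U)$ with sum $u$; a countable partition of $u$ is a disjoint family $(u_n)_{n\in\mathbb N}\subset\mathrm{Idem}(U)$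 with $\sup_n u_n=u$; $\mathcal P(u)$ is the set of countable partitions of $u$. Simple elements: $\mathcal S(U)=\{\sum_{i=1}^n\lambda_iu_i:\lambda_i\in\mathbb R,\ (u_i)_{i=1}^n\text{ a finite partition of }\mathbf 1_U\}$. An order-preserving map is $\sigma$-order-continuous if it preserves existing suprema of non-decreasing sequences and existing infima of non-increasing sequences. A localisable $f$-algebra is a Dedekind $\sigma$-complete $f$-algebra whose multiplication is $\sigma$-order-continuous on $U^+\times U^+$ and such that every $u\in U^+$ is the supremum of a non-decreasing sequence in $\mathcal S(U)\cap U^+$. Metric notions (products of metric spaces carry the sum distance). A metric Riesz space $(U,\mathsf d_U)$ is a Dedekind $\sigma$-complete Riesz space with a complete distance such that $\mathsf d_U(u,0)=\mathsf d_U(|u|,0)$, $\mathsf d_U(u+w,v+w)=\mathsf d_U(u,v)$, and $\mathsf d_U(u,0)\le\mathsf d_U(v,0)$ whenever $0\le u\le v$. A metric $f$-algebra is a localisable $f$-algebra $U$ with a distance $\mathsf d_U$ such that $(U,\mathsf d_U)$ is a metric Riesz space, the multiplication $U\times U\to U$ is continuous, $\mathcal S(U)$ is dense, and $\mathsf d_U(\varepsilon\mathbf 1_U,0)\to0$ as $\varepsilon\searrow0$. A metric $f$-structure is a triple $(\mathcal U,U,V)$ where $\mathcal U$ is a localisable $f$-algebra; $(U,\mathsf d_U)$ is a metric $f$-algebra that is a solid $f$-subalgebra of $\mathcal U$; $(V,\mathsf d_V)$ is a metric Riesz space that is a solid Riesz subspace of $\mathcal U$; $UV=V$ (where $UV=\{uv:u\in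 U,v\in V\}$) and the multiplication $U\times V\to V$ is continuous; and for any $(u_n)_n\in\mathcal P(\mathbf 1_U)$ and $\varepsilon>0$ there is $\delta>0$ such that, whenever $(v_n)_n\subset V^+$ satisfies $\sum_n\mathsf d_V(u_nv_n,0)\le\delta$, the family $(u_nv_n)_n$ is order-bounded in $V$ and $\mathsf d_V(\sup_nu_nv_n,0)\le\varepsilon$. A homomorphism of metric $f$-structures $(\mathcal U_1,U_1,V_1)\to(\mathcal U_2,U_2,V_2)$ is a homomorphism of $f$-algebras $\phi\colon\mathcal U_1\to\mathcal U_2$ such that $\phi|_{U_1}\colon U_1\to U_2$ is a Lipschitz, $\sigma$-order-continuous homomorphism of $f$-algebras and $\phi|_{V_1}\colon V_1\to V_2$ is a Lipschitz homomorphism of Riesz spaces. Modules. A $V$-normed $U$-module over a metric $f$-structure $(\mathcal U,U,V)$ is a $U$-module $\mathscr M$ (a real vector space via $\lambda v=(\lambda\mathbf 1_U)\cdot v$) with a map $|\cdot|\colon\mathscr M\to V^+$ such that $|v|=0\iff v=0$, $|v+w|\le|v|+|w|$, $|u\cdot v|=|u||v|$, and the glueing property holds: if $(u_n)_n\in\mathcal P(\mathbf 1_U)$ and $(v_n)_n\subset\mathscr M$ are such that $(|u_n\cdot v_n|)_n$ is order-bounded in $V$ (one writes $(u_n,v_n)_n\in\mathrm{Adm}(\mathscr M)$), then there is a (necessarily unique) $v\in\mathscr M$ with $u_n\cdot v=u_n\cdot v_n$ for all $n$, denoted $\sum_{n\in\mathbb N}u_n\cdot v_n$. $\mathscr M$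 has the distance $\mathsf d_{\mathscr M}(v,w)=\mathsf d_V(|v-w|,0)$; if it is complete, $\mathscr M$ is a $V$-Banach $U$-module. For $\varnothing\ne S\subset\mathscr M$, $\mathscr G(S)=\{\sum_nu_n\cdot v_n:(u_n)_n\in\mathcal P(\mathbf 1_U),(v_n)_n\subset S,(u_n,v_n)_n\in\mathrm{Adm}(\mathscr M)\}$. An isomorphism of $V$-Banach $U$-modules is a $U$-linear bijection $\Phi$ with $|\Phi v|=|v|$ for all $v$ (i.e. an invertible morphism in the category whose morphisms are the $U$-linear maps $T$ with $|Tv|\le|v|$). *)

(* Defs.v *)
From HB Require Import structures.
From mathcomp Require Import all_boot all_order all_algebra.
From mathcomp Require Import all_classical all_reals all_analysis.

Set Implicit Arguments.
Unset Strict Implicit.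
Unset Printing Implicit Defensive.

Import Order.TTheory GRing.Theory Num.Theory.
Import numFieldNormedType.Exports.

Local Open Scope classical_set_scope.
Local Open Scope ring_scope.

(* The lattice structure is not [Order.Lattice]: HB refuses a structure that    *)
(* joins it with [GRing.Zmodule] once [Num.RealDomain] is declared. The laws    *)
(* [rmeetP] and [rjoinP] are those of [Order.POrder_MeetJoin_isLattice].        *)
HB.mixin Record POrder_isRiesz (R : realType) U
    of GRing.Lmodule R U & Order.POrder ring_display U := {
  rmeet : U -> U -> U;
  rjoin : U -> U -> U;
  rmeetP : forall u v w : U, (u <= rmeet v w) = (u <= v) && (u <= w);
  rjoinP : forall u v w : U, (rjoin u v <= w) = (u <= w) && (v <= w);
  riesz_leD : forall u v w : U, u <= v -> u + w <= v + w;
  riesz_scale_ge0 : forall (l : R) (u : U), 0 <= l -> 0 <= u -> 0 <= l *: u }.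

#[short(type="rieszType")]
HB.structure Definition RieszSpace (R : realType) :=
  {U of GRing.Lmodule R U & Order.POrder ring_display U & POrder_isRiesz R U}.

(* For the same reason (with [Num.NumDomain]) the ring structure comes          *)
(* afterwards, as an instance on every f-algebra. It is a [comPzRingType]: the  *)
(* zero f-algebra, where [1 = 0], is allowed, so [comAlgType R] does not fit.   *)
HB.mixin Record Riesz_isFAlgebra (R : realType) U of RieszSpace R U := {
  fone : U;
  fmul : U -> U -> U;
  fmulA : associative fmul;
  fmulC : commutative fmul;
  fmul1 : left_id fone fmul;
  fmulDl : left_distributive fmul +%R;
  fscaleAl : forall (l : R) (u v : U), l *: fmul u v = fmul (l *: u) v;
  fmul_ge0 : forall u v : U, 0 <= u -> 0 <= v -> 0 <= fmul u v;
  fmeetM : forall u v w : U,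
    rmeet u v = 0 -> 0 <= w -> rmeet (fmul u w) v = 0 }.

#[short(type="fAlgType")]
HB.structure Definition FAlgebra (R : realType) :=
  {U of RieszSpace R U & Riesz_isFAlgebra R U}.

HB.instance Definition _ (R : realType) (U : fAlgType R) :=
  GRing.Zmodule_isComPzRing.Build (FAlgebra.sort U)
    (@fmulA R U) (@fmulC R U) (@fmul1 R U) (@fmulDl R U).

Section Order.
Context {d : Order.disp_t} {T : porderType d}.

Definition order_bounded (A : set T) := has_lbound A /\ has_ubound A.

Definition dedekind_sigma_complete :=
  (forall A : set T, countable A -> A !=set0 -> has_ubound A ->
     supremums A !=set0) /\
  (forall A : set T, countable A -> A !=set0 -> has_lbound A ->
     infimums A !=set0).
End Order.
Arguments dedekind_sigma_complete {d} T.

Definition sigma_order_continuous {d1 d2 : Order.disp_t}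
    {A : porderType d1} {B : porderType d2} (f : A -> B) :=
  [/\ {homo f : x y / (x <= y)%O},
      forall (u : nat -> A) (s : A), nondecreasing_seq u ->
        supremums (range u) s -> supremums (range (f \o u)) (f s) &
      forall (u : nat -> A) (s : A), nonincreasing_seq u ->
        infimums (range u) s -> infimums (range (f \o u)) (f s)].

Section Distance.
Context {R : realType}.

Definition is_distance {T : Type} (d : T -> T -> R) :=
  [/\ forall x y, 0 <= d x y,
      forall x y, d x y = 0 <-> x = y,
      forall x y, d x y = d y x &
      forall x y z, d x z <= d x y + d y z].

Definition complete_distance {T : Type} (d : T -> T -> R) :=
  forall u : nat -> T,
    (forall e, 0 < e -> exists n0, forall m n,
       (n0 <= m)%N -> (n0 <= n)%N -> d (u m) (u n) < e) ->
    exists l, d (u n) l @[n --> \oo] --> 0.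

Definition dense_for {T : Type} (d : T -> T -> R) (A : set T) :=
  forall x e, 0 < e -> exists2 y, A y & d x y < e.

Definition continuous2_for {A B C : Type} (dA : A -> A -> R)
    (dB : B -> B -> R) (dC : C -> C -> R) (f : A -> B -> C) :=
  forall a b e, 0 < e -> exists2 delta, 0 < delta &
    forall a' b', dA a a' + dB b b' < delta -> dC (f a b) (f a' b') < e.

Definition lipschitz_for {A B : Type} (dA : A -> A -> R) (dB : B -> B -> R)
    (f : A -> B) :=
  exists2 L : R, 0 <= L & forall x y, dB (f x) (f y) <= L * dA x y.
End Distance.

Section Riesz.
Context {R : realType}.

Definition rabs {U : rieszType R} (u : U) : U := rjoin u (- u).

Definition disjoint_family {U : rieszType R} {I : Type} (u : I -> U) :=
  forall i j, i <> j -> rmeet (rabs (u i)) (rabs (u j)) = 0.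

Definition riesz_hom {U V : rieszType R} (f : U -> V) :=
  linear f /\
  forall u v, rmeet u v = 0 -> rmeet (f u) (f v) = 0.

Definition solid_set {U : rieszType R} (A : set U) :=
  forall u v, A u -> rabs v <= rabs u -> A v.

Definition metric_riesz {U : rieszType R} (d : U -> U -> R) :=
  [/\ dedekind_sigma_complete U,
      is_distance d /\ complete_distance d,
      forall u, d u 0 = d (rabs u) 0,
      forall u v w, d (u + w) (v + w) = d u v &
      forall u v, 0 <= u -> u <= v -> d u 0 <= d v 0].
End Riesz.

Section FAlgebraTheory.
Context {R : realType}.

Definition falg_hom {U V : fAlgType R} (f : U -> V) :=
  [/\ riesz_hom f, f 1 = 1 & forall u v, f (u * v) = f u * f v].

Context {U : fAlgType R}.

Definition idempotents : set U := [set u | u * u = u].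

Definition finite_partition (e : U) (n : nat) (u : 'I_n -> U) :=
  [/\ forall i, idempotents (u i), disjoint_family u & \sum_i u i = e].

Definition countable_partition (e : U) (u : nat -> U) :=
  [/\ forall i, idempotents (u i), disjoint_family u & supremums (range u) e].

Definition simple_elts : set U :=
  [set s | exists n (l : 'I_n -> R) (u : 'I_n -> U),
     finite_partition 1 u /\ s = \sum_i l i *: u i].

(* Suprema and infima in the ordered product U^+ * U^+ are componentwise, and  *)
(* those of sequences of U^+ are the same in U^+ as in U.                      *)
Definition mul_sigma_order_continuous :=
  (forall (u v : nat -> U) (a b : U),
     (forall n, 0 <= u n) -> (forall n, 0 <= v n) ->
     nondecreasing_seq u -> nondecreasing_seq v ->
     supremums (range u) a -> supremums (range v) b ->
     supremums (range (fun n => u n * v n)) (a * b)) /\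
  (forall (u v : nat -> U) (a b : U),
     (forall n, 0 <= u n) -> (forall n, 0 <= v n) ->
     nonincreasing_seq u -> nonincreasing_seq v ->
     infimums (range u) a -> infimums (range v) b ->
     infimums (range (fun n => u n * v n)) (a * b)).

Definition localisable :=
  [/\ dedekind_sigma_complete U,
      mul_sigma_order_continuous &
      forall u : U, 0 <= u -> exists s : nat -> U,
        [/\ nondecreasing_seq s,
            forall n, simple_elts (s n) /\ 0 <= s n &
            supremums (range s) u]].

Definition metric_falg (d : U -> U -> R) :=
  [/\ localisable,
      metric_riesz d,
      continuous2_for d d d *%R,
      dense_for d simple_elts &
      d (e *: (1 : U)) 0 @[e --> (0 : R)^'+] --> (0 : R)].
End FAlgebraTheory.
Arguments localisable {R} U.

Record rieszSubspace (R : realType) (X : rieszType R) := RieszSubspace {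
  rsub_set :> set X;
  rsub0 : rsub_set 0;
  rsub_lin : forall (l : R) u v, rsub_set u -> rsub_set v ->
    rsub_set (l *: u + v);
  rsub_join : forall u v, rsub_set u -> rsub_set v ->
    rsub_set (rjoin u v);
  rsub_meet : forall u v, rsub_set u -> rsub_set v ->
    rsub_set (rmeet u v) }.

Record fSubalgebra (R : realType) (X : fAlgType R) := FSubalgebra {
  fsub_riesz :> rieszSubspace X;
  fsub1 : rsub_set fsub_riesz 1;
  fsubM : forall u v, rsub_set fsub_riesz u -> rsub_set fsub_riesz v ->
    rsub_set fsub_riesz (u * v) }.

(* The elements of a Riesz subspace, with the structures induced from the      *)
(* ambient space.                                                              *)
Record sub_of (R : realType) (X : rieszType R) (S : rieszSubspace X) :=
  SubOf { sub_val : X; _ : sub_val \in (S : set X) }.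

Section SubRiesz.
Context {R : realType} {X : rieszType R} (S : rieszSubspace X).

HB.instance Definition _ := [isSub of sub_of S for @sub_val R X S].
HB.instance Definition _ := [Choice of sub_of S by <:].

Let submodS : subsemimod_closed (mem (S : set X)).
Proof.
split=> [|l u /set_mem uS]; last first.
  by apply/mem_set; rewrite -[l *: u]addr0; apply: rsub_lin => //; apply: rsub0.
split=> [|u v /set_mem uS /set_mem vS]; first exact/mem_set/rsub0.
by apply/mem_set; rewrite -[u]scale1r; apply: rsub_lin.
Qed.

HB.instance Definition _ :=
  GRing.SubChoice_isSubLmodule.Build R X (mem (S : set X)) (sub_of S) submodS.

HB.instance Definition _ := Order.SubChoice_isSubPOrder.Build ring_display X
  (mem (S : set X)) ring_display (sub_of S).

Let meetS (u v : sub_of S) : rmeet (val u) (val v) \in (S : set X).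
Proof. by apply/mem_set/rsub_meet; apply/set_mem/valP. Qed.

Let joinS (u v : sub_of S) : rjoin (val u) (val v) \in (S : set X).
Proof. by apply/mem_set/rsub_join; apply/set_mem/valP. Qed.

Definition sub_meet (u v : sub_of S) : sub_of S := SubOf (meetS u v).
Definition sub_join (u v : sub_of S) : sub_of S := SubOf (joinS u v).

Let sub_meetP (u v w : sub_of S) :
  (u <= sub_meet v w) = (u <= v) && (u <= w).
Proof. by rewrite -!Order.le_val rmeetP. Qed.

Let sub_joinP (u v w : sub_of S) :
  (sub_join u v <= w) = (u <= w) && (v <= w).
Proof. by rewrite -!Order.le_val rjoinP. Qed.

Let sub_leD (u v w : sub_of S) : u <= v -> u + w <= v + w.
Proof. by rewrite -!Order.le_val !raddfD; apply: riesz_leD. Qed.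

Let sub_scale_ge0 (l : R) (u : sub_of S) : 0 <= l -> 0 <= u -> 0 <= l *: u.
Proof.
by move=> l0; rewrite -!Order.le_val linearZ raddf0; apply: riesz_scale_ge0.
Qed.

HB.instance Definition _ := POrder_isRiesz.Build R (sub_of S)
  sub_meetP sub_joinP sub_leD sub_scale_ge0.

End SubRiesz.

Section SubFAlgebra.
Context {R : realType} {X : fAlgType R} (S : fSubalgebra X).

Let subring1 : (1 : X) \in (S : set X).
Proof. exact/mem_set/fsub1. Qed.

Let subringM (u v : sub_of S) : (val u * val v : X) \in (S : set X).
Proof. by apply/mem_set/fsubM; apply/set_mem/valP. Qed.

Definition sub_one : sub_of S := SubOf subring1.
Definition sub_mul (u v : sub_of S) : sub_of S := SubOf (subringM u v).

Let sub_mulA : associative sub_mul.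
Proof. by move=> u v w; apply: val_inj; apply: mulrA. Qed.

Let sub_mulC : commutative sub_mul.
Proof. by move=> u v; apply: val_inj; apply: mulrC. Qed.

Let sub_mul1 : left_id sub_one sub_mul.
Proof. by move=> u; apply: val_inj; apply: mul1r. Qed.

Let sub_mulDl : left_distributive sub_mul +%R.
Proof. by move=> u v w; apply: val_inj; apply: mulrDl. Qed.

Let sub_scaleAl (l : R) (u v : sub_of S) :
  l *: sub_mul u v = sub_mul (l *: u) v.
Proof. by apply: val_inj; apply: fscaleAl. Qed.

Let sub_mul_ge0 (u v : sub_of S) : 0 <= u -> 0 <= v -> 0 <= sub_mul u v.
Proof. by rewrite -!Order.le_val; apply: fmul_ge0. Qed.

Let sub_meetM (u v w : sub_of S) :
  rmeet u v = 0 -> 0 <= w -> rmeet (sub_mul u w) v = 0.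
Proof.
move=> /(congr1 val) uv0; rewrite -Order.le_val => w0; apply: val_inj.
exact: fmeetM.
Qed.

HB.instance Definition _ := Riesz_isFAlgebra.Build R (sub_of S)
  sub_mulA sub_mulC sub_mul1 sub_mulDl sub_scaleAl sub_mul_ge0 sub_meetM.

HB.instance Definition _ :=
  GRing.ComPzRing.copy (sub_of S) (FAlgebra.sort (sub_of S)).

End SubFAlgebra.

Section Act.
Context {R : realType} {X : fAlgType R} (U : fSubalgebra X)
        (V : rieszSubspace X).
Hypothesis UV : [set u * v | u in rsub_set U & v in rsub_set V] = V.

Let actP (u : sub_of U) (v : sub_of V) : (val u * val v : X) \in (V : set X).
Proof.
apply/mem_set; case/seteqP: UV => + _; apply.
by exists (val u); [exact/set_mem/valP|exists (val v) => //; exact/set_mem/valP].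
Qed.

Definition sub_act (u : sub_of U) (v : sub_of V) : sub_of V :=
  SubOf (actP u v).
End Act.

Record metricFStructure (R : realType) := MetricFStructure {
  ambient : fAlgType R;
  subU : fSubalgebra ambient;
  subV : rieszSubspace ambient;
  distU : sub_of subU -> sub_of subU -> R;
  distV : sub_of subV -> sub_of subV -> R;
  ambient_localisable : localisable ambient;
  subU_solid : solid_set subU;
  subU_metric : metric_falg distU;
  subV_solid : solid_set subV;
  subV_metric : metric_riesz distV;
  mulUV : [set u * v | u in rsub_set subU & v in rsub_set subV] = subV;
  mulUV_continuous : continuous2_for distU distV distV (sub_act mulUV);
  mulUV_glue : forall u : nat -> sub_of subU, countable_partition 1 u ->
    forall e, 0 < e -> exists2 delta, 0 < delta &
    forall v : nat -> sub_of subV, (forall n, 0 <= v n) ->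
    (\sum_(0 <= n <oo) (distV (sub_act mulUV (u n) (v n)) 0)%:E
       <= delta%:E)%E ->
    order_bounded (range (fun n => sub_act mulUV (u n) (v n))) /\
    exists2 s, supremums (range (fun n => sub_act mulUV (u n) (v n))) s &
      distV s 0 <= e }.

Section StructureTypes.
Context {R : realType} (S : metricFStructure R).

Definition elU : fAlgType R := sub_of (subU S).
Definition elV : rieszType R := sub_of (subV S).
Definition uv_act (u : elU) (v : elV) : elV := sub_act (mulUV S) u v.
End StructureTypes.

Definition sub_restrict {R : realType} {X Y : rieszType R}
    (A : rieszSubspace X) (B : rieszSubspace Y) (f : X -> Y)
    (fAB : forall x, x \in (A : set X) -> f x \in (B : set Y))
    (x : sub_of A) : sub_of B :=
  SubOf (fAB (val x) (valP x)).

Record metricFHom (R : realType) (S1 S2 : metricFStructure R) := MetricFHom {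
  mhom : ambient S1 -> ambient S2;
  mhom_falg : falg_hom mhom;
  mhom_subU : forall x, x \in (subU S1 : set (ambient S1)) ->
    mhom x \in (subU S2 : set (ambient S2));
  mhom_subV : forall x, x \in (subV S1 : set (ambient S1)) ->
    mhom x \in (subV S2 : set (ambient S2));
  mhomU : elU S1 -> elU S2 := sub_restrict mhom_subU;
  mhomV : elV S1 -> elV S2 := sub_restrict mhom_subV;
  mhomU_lipschitz : lipschitz_for (@distU R S1) (@distU R S2) mhomU;
  mhomU_sigma : sigma_order_continuous mhomU;
  mhomU_falg : falg_hom mhomU;
  mhomV_lipschitz : lipschitz_for (@distV R S1) (@distV R S2) mhomV;
  mhomV_riesz : riesz_hom mhomV }.

Section Modules.
Context {R : realType} (S : metricFStructure R).

Record normedModule := NormedModule {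
  nmod :> lmodType (elU S);
  nmod_norm : nmod -> elV S;
  nmod_norm_ge0 : forall v, 0 <= nmod_norm v;
  nmod_norm_eq0 : forall v, nmod_norm v = 0 <-> v = 0;
  nmod_ler_normD : forall v w,
    nmod_norm (v + w) <= nmod_norm v + nmod_norm w;
  nmod_normZ : forall (u : elU S) v,
    nmod_norm (u *: v) = uv_act (rabs u) (nmod_norm v);
  nmod_glue : forall (u : nat -> elU S) (v : nat -> nmod),
    countable_partition 1 u ->
    order_bounded (range (fun n => nmod_norm (u n *: v n))) ->
    exists w, forall n, u n *: w = u n *: v n }.

Definition adm {M : normedModule} (u : nat -> elU S) (v : nat -> M) :=
  countable_partition 1 u /\
  order_bounded (range (fun n => nmod_norm (u n *: v n))).

(* The element [w] below is unique, i.e. it is [\sum_n u n *: v n].            *)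
Definition glued {M : normedModule} (A : set M) : set M :=
  [set w | exists (u : nat -> elU S) (v : nat -> M),
     [/\ adm u v, forall n, A (v n) & forall n, u n *: w = u n *: v n]].

Definition nmod_dist {M : normedModule} (v w : M) : R :=
  distV (nmod_norm (v - w)) 0.

Record banachModule := BanachModule {
  bmod :> normedModule;
  bmod_complete : complete_distance (@nmod_dist bmod) }.

Definition rscale {M : normedModule} (l : R) (v : M) : M :=
  (l *: (1 : elU S)) *: v.

Definition module_iso {M N : normedModule} (f : M -> N) :=
  [/\ linear f, bijective f & forall v, nmod_norm (f v) = nmod_norm v].
End Modules.

(* Scalar multiplication by [R] on the two modules, over different rings, is   *)
(* [rscale]; hence [linear] from the library does not apply.                   *)
Definition real_linear {R : realType} {S1 S2 : metricFStructure R}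
    {M : normedModule S1} {N : normedModule S2} (T : M -> N) :=
  forall (l : R) v w, T (rscale l v + w) = rscale l (T v) + T w.

Definition module_pushforward {R : realType} {S1 S2 : metricFStructure R}
    (phi : metricFHom S1 S2) (M : normedModule S1) (N : banachModule S2)
    (T : M -> N) :=
  [/\ real_linear T,
      forall v, nmod_norm (T v) = mhomV phi (nmod_norm v) &
      dense_for (@nmod_dist R S2 N) (glued (range T))].

(* Main.v *)
Require Import Defs.
From HB Require Import structures.
From mathcomp Require Import all_boot all_order all_algebra.
From mathcomp Require Import all_classical all_reals all_analysis.
From mathcomp Require Import ring.

(** The pushforward is built without formal sums, quotients or completions: its
elements are functions.  In any solution (N, T), an element x of N is determined
by the function f(v) = |x - T v| from M to V_2.  These functions satisfy the two
inequalities of Katetov, namely f v <= f w + q (v - w) and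
q (v - w) <= f v + f w with q v = phi |v|, and density of the glued elements says
exactly that f is small: up to a V_2-small error, f is made to vanish by choosing
a point v_n on each piece u_n of a countable partition of unity.  The set of all
small Katetov functions (record [katetov]) is the pushforward, and an arbitrary
solution is compared with it by sending x to its function ([katetov_of]).  All
this uses M only through the real vector space M with its V_2-valued seminorm q.

Two facts about smallness carry the construction.  First, an element of V_2 that
lies below all values of a small function is nonpositive ([small_le0]); all
equalities between Katetov functions, such as the module axioms, are checked
this way ([katetov_eq]).  Secondly, [katetov_build] produces points: a family
p_i of M with small errors H_i such that q (p_i - p_j) <= H_i + H_j has a limit, a
Katetov function f with f (p_i) <= H_i.  It rests on [small_squeeze], where
Dedekind sigma-completeness of V_2 suffices since a small function is already
small on a countable set of indices.  Every operation is such a limit: f + g is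
the limit of v + w with error f v + g w, and u f is the limit of r v over real r,
with error |u - r| f 0 + |r| f v, which is small because simple elements are
dense in U_2 and multiplication is continuous.  Completeness and glueing are
limits too; the latter uses the uniform glueing axiom of metric f-structures to
control infinitely many errors at once.

For uniqueness, x |-> |x - T' .| is U_2-linear and norm preserving, it sends T' v
to the function of v, and it is onto because its image is complete and contains
the glued elements.  Its inverse is the required isomorphism, and every other
isomorphism commuting with the maps from M preserves the numbers |x - T v|,
hence agrees with it. *)

Set Implicit Arguments.
Unset Strict Implicit.
Unset Printing Implicit Defensive.

Import Order.TTheory GRing.Theory Num.Theory.
Import numFieldNormedType.Exports.

Local Open Scope classical_set_scope.
Local Open Scope ring_scope.

(** * Riesz spaces *)

Section RieszTheory.
Context {R : realType} {U : rieszType R}.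
Implicit Types u v w x y : U.

Lemma riesz_subr_ge0 u v : (0 <= v - u) = (u <= v).
Proof.
apply/idP/idP => [/(riesz_leD _ _ u)|/(riesz_leD _ _ (- u))].
  by rewrite add0r subrK.
by rewrite subrr.
Qed.

Lemma riesz_addr_ge0 u v : 0 <= u -> 0 <= v -> 0 <= u + v.
Proof.
by move=> u0 v0; apply: (le_trans v0); have := riesz_leD _ _ v u0;
  rewrite add0r.
Qed.

Lemma riesz_lerD u v x y : u <= v -> x <= y -> u + x <= v + y.
Proof.
move=> uv xy; apply: (le_trans (riesz_leD _ _ x uv)).
by rewrite ![v + _]addrC; apply: riesz_leD.
Qed.

Lemma riesz_le_sum (I : Type) (s : seq I) (F G : I -> U) :
  (forall i, F i <= G i) -> \sum_(i <- s) F i <= \sum_(i <- s) G i.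
Proof.
by move=> FG; apply: (big_ind2 (fun a b : U => a <= b)) => // *;
  apply: riesz_lerD.
Qed.

Lemma riesz_lerN u v : (- u <= - v) = (v <= u).
Proof. by rewrite -[LHS]riesz_subr_ge0 opprK addrC riesz_subr_ge0. Qed.

(** The lemmas [riesz_le_by1] to [riesz_le_by3] reduce a linear consequence of
inequalities to an identity, which is then left to the ring normaliser. *)
Lemma riesz_le_by1 x y u v : u <= v -> y - x = v - u -> x <= y.
Proof. by move=> + e; rewrite -riesz_subr_ge0 -e riesz_subr_ge0. Qed.

Lemma riesz_le_by2 x y u v u' v' : u <= v -> u' <= v' ->
  y - x = (v - u) + (v' - u') -> x <= y.
Proof.
rewrite -[u <= v]riesz_subr_ge0 -[u' <= v']riesz_subr_ge0 -[x <=
  y]riesz_subr_ge0.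
by move=> ? ? ->; apply: riesz_addr_ge0.
Qed.

Lemma riesz_le_by3 x y u v u' v' u'' v'' : u <= v -> u' <= v' -> u'' <= v'' ->
  y - x = (v - u) + (v' - u') + (v'' - u'') -> x <= y.
Proof.
move=> h h' h'' e; apply: (riesz_le_by2 (riesz_lerD h h') h''); rewrite e.
by rewrite opprD [v + v' + _]addrACA.
Qed.

Lemma riesz_ge0_of_double u : 0 <= u + u -> 0 <= u.
Proof.
move=> uu; have -> : u = (2^-1 : R) *: (u + u).
  by rewrite scalerDr -scalerDl -[2^-1]mul1r -splitr scale1r.
by apply: riesz_scale_ge0 => //; rewrite invr_ge0 ler0n.
Qed.

Lemma ler_rabs u : u <= rabs u.
Proof. by have := lexx (rabs u); rewrite {1}/rabs rjoinP => /andP[]. Qed.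

Lemma lerN_rabs u : - u <= rabs u.
Proof. by have := lexx (rabs u); rewrite {1}/rabs rjoinP => /andP[]. Qed.

Lemma rabs_ler u v : (rabs u <= v) = (u <= v) && (- u <= v).
Proof. exact: rjoinP. Qed.

Lemma rabs_ge0 u : 0 <= rabs u.
Proof.
apply: riesz_ge0_of_double;
  apply: (le_trans _ (riesz_lerD (ler_rabs u) (lerN_rabs u))).
by rewrite subrr.
Qed.

Lemma rabs_ge0_id u : 0 <= u -> rabs u = u.
Proof.
move=> u0; apply/le_anti; rewrite ler_rabs andbT rabs_ler lexx/=.
by apply: (le_trans _ u0); rewrite -oppr0 riesz_lerN.
Qed.

Lemma rabsN u : rabs (- u) = rabs u.
Proof.
apply/le_anti; rewrite !rabs_ler opprK ler_rabs lerN_rabs /=.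
by have := lerN_rabs (- u); rewrite opprK => ->; rewrite ler_rabs.
Qed.

Lemma rabsD u v : rabs (u + v) <= rabs u + rabs v.
Proof.
rewrite rabs_ler opprD; apply/andP; split; apply: riesz_lerD;
  by rewrite ?ler_rabs ?lerN_rabs.
Qed.

Lemma rjoin_ger0 u : 0 <= rjoin u 0.
Proof. by have := lexx (rjoin u 0); rewrite {1}rjoinP => /andP[]. Qed.
Lemma rjoin_ge u : u <= rjoin u 0.
Proof. by have := lexx (rjoin u 0); rewrite {1}rjoinP => /andP[]. Qed.

Lemma rmeet_lel u v : rmeet u v <= u.
Proof. by have := lexx (rmeet u v); rewrite {1}rmeetP => /andP[]. Qed.
Lemma rmeet_ler u v : rmeet u v <= v.
Proof. by have := lexx (rmeet u v); rewrite {1}rmeetP => /andP[]. Qed.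

Lemma rmeetC u v : rmeet u v = rmeet v u.
Proof. by apply/le_anti; rewrite !rmeetP !rmeet_lel !rmeet_ler. Qed.

Lemma riesz_scale_le (l : R) u v : 0 <= l -> u <= v -> l *: u <= l *: v.
Proof.
by move=> l0;
  rewrite -[u <= v]riesz_subr_ge0 -[_ <= l *: v]riesz_subr_ge0 -scalerBr;
    apply: riesz_scale_ge0.
Qed.

End RieszTheory.

(** * f-algebras and their idempotents *)

Section FAlg.
Context {R : realType} {X : fAlgType R}.
Implicit Types u v w x y z e : X.

(** The image of a real number in the f-algebra, kept folded so that the ring
normaliser treats it as an atom. *)
Definition fconst (l : R) : X := l *: (1 : X).

Lemma fscaleE (l : R) u : l *: u = fconst l * u.
Proof. by have := fscaleAl l (1 : X) u; rewrite [fmul _ _]mul1r. Qed.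

Lemma fconst1 : fconst 1 = 1.
Proof. exact: scale1r. Qed.

Lemma fconstD l m : fconst (l + m) = fconst l + fconst m.
Proof. exact: scalerDl. Qed.

Lemma fconstN l : fconst (- l) = - fconst l.
Proof. exact: scaleNr. Qed.

Lemma fconstM l m : fconst (l * m) = fconst l * fconst m.
Proof. by rewrite -fscaleE /fconst scalerA. Qed.

Lemma falg_mulr_ge0 u v : 0 <= u -> 0 <= v -> 0 <= u * v.
Proof. exact: fmul_ge0. Qed.

Lemma falg_lerM u x y : 0 <= u -> x <= y -> u * x <= u * y.
Proof.
by move=> u0;
  rewrite -[x <= y]riesz_subr_ge0 -[_ <= u * y]riesz_subr_ge0 -mulrBr;
    apply: fmul_ge0.
Qed.

(** The f-algebra axiom, used once on each factor, makes [u * v] disjoint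
from itself. *)
Lemma disjoint_mul0 u v : 0 <= u -> 0 <= v -> rmeet u v = 0 -> u * v = 0.
Proof.
move=> u0 v0 uv; have h1 : rmeet (u * v) v = 0 by apply: fmeetM.
have h2 : rmeet (v * u) (u * v) = 0 by apply: fmeetM => //; rewrite rmeetC.
by apply/le_anti; rewrite falg_mulr_ge0// andbT -h2 rmeetP mulrC lexx.
Qed.

(** Only one inequality needs an argument, the other being the same one for
[- u]. *)
Lemma rjoin0_sub u : u = rjoin u 0 - rjoin (- u) 0.
Proof.
have h v : rjoin v 0 - v <= rjoin (- v) 0.
  rewrite -[_ - _ <= _](riesz_subr_ge0 (rjoin v 0 - v)) opprD opprK addrA
    addrAC.
  rewrite riesz_subr_ge0 rjoinP.
  rewrite -riesz_subr_ge0 addrK rjoin_ger0/=.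
  by rewrite -riesz_subr_ge0 subr0 -{2}[v]opprK riesz_subr_ge0 rjoin_ge.
apply/le_anti; apply/andP; split.
  have := h (- u); rewrite opprK => {}h.
  by apply: (riesz_le_by1 h); ring.
by apply: (riesz_le_by1 (h u)); ring.
Qed.

Lemma meet_pos_neg u : rmeet (rjoin u 0) (rjoin (- u) 0) = 0.
Proof.
set p := rjoin u 0; set n := rjoin (- u) 0; set m := rmeet p n.
have upn : u = p - n by exact: rjoin0_sub.
apply/le_anti; rewrite rmeetP !rjoin_ger0 !andbT.
have : p <= p - m.
  rewrite {1}/p rjoinP riesz_subr_ge0 rmeet_lel andbT.
  by rewrite -riesz_subr_ge0; apply: (riesz_le_by1 (rmeet_ler p n));
    rewrite -/m upn; ring.
by move=> h; apply: (riesz_le_by1 h); ring.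
Qed.

(** The positive and negative parts of [e] multiply to 0, so [e = e * e] is a
sum of two squares of positive elements. *)
Lemma idempotent_ge0 e : idempotents e -> 0 <= e.
Proof.
move=> <-; set p := rjoin e 0; set n := rjoin (- e) 0.
have pn : p * n = 0 by apply: disjoint_mul0; rewrite ?rjoin_ger0// meet_pos_neg.
have -> : e * e = p * p + n * n by rewrite (rjoin0_sub e) -/p -/n; ring: pn.
by apply: riesz_addr_ge0; apply: falg_mulr_ge0; apply: rjoin_ger0.
Qed.

Lemma idempotentC e : idempotents e -> idempotents (1 - e).
Proof. rewrite /idempotents/= => ee; ring: ee. Qed.

Lemma idempotent_le1 e : idempotents e -> e <= 1.
Proof. by move=> /idempotentC/idempotent_ge0; rewrite riesz_subr_ge0. Qed.

Lemma falg_ler01 : (0 : X) <= 1.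
Proof. by apply: idempotent_ge0; rewrite /idempotents/= mulr1. Qed.

Lemma fconst_ge0 (l : R) : 0 <= l -> 0 <= fconst l.
Proof. by move=> l0; apply: riesz_scale_ge0 => //; apply: falg_ler01. Qed.

Lemma idempotent_disjoint e e' : idempotents e -> idempotents e' ->
  e * e' = 0 -> rmeet (rabs e) (rabs e') = 0.
Proof.
move=> ie ie' ee'; rewrite !rabs_ge0_id ?idempotent_ge0//.
set m := rmeet e e'.
have m0 : 0 <= m by rewrite rmeetP !idempotent_ge0.
apply/le_anti; rewrite m0 andbT.
have h1 : (1 - e) * m <= (1 - e) * e.
  by apply: falg_lerM (rmeet_lel _ _); rewrite riesz_subr_ge0 idempotent_le1.
have h2 : e * m <= e * e'.
  by apply: falg_lerM (rmeet_ler _ _); rewrite idempotent_ge0.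
by apply: (riesz_le_by2 h1 h2); rewrite ee'; ring: (ie : e * e = e).
Qed.

Lemma idempotent_mul0 e e' : idempotents e -> idempotents e' ->
  rmeet (rabs e) (rabs e') = 0 -> e * e' = 0.
Proof.
by move=> ie ie'; rewrite !rabs_ge0_id ?idempotent_ge0//;
  apply: disjoint_mul0; apply: idempotent_ge0.
Qed.

Lemma rabs_fconst (l : R) : rabs (fconst l) = fconst `|l|.
Proof.
have [l0|l0] := ger0P l; first by rewrite rabs_ge0_id ?fconst_ge0.
by rewrite -rabsN -fconstN rabs_ge0_id// fconst_ge0// ltW// oppr_gt0.
Qed.

(** The element [e * rabs z' + (1 - e) * rabs z] dominates both [z] and
[- z], so it dominates [rabs z]. *)
Lemma idempotent_rabs_le e z z' : idempotents e -> e * z = e * z' ->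
  e * rabs z <= e * rabs z'.
Proof.
move=> ie ez; have ee : e * e = e by exact: ie.
have e0 := idempotent_ge0 ie; have e'0 := idempotent_ge0 (idempotentC ie).
have h : rabs z <= e * rabs z' + (1 - e) * rabs z.
  rewrite rabs_ler; apply/andP; split.
    have h1 := falg_lerM e0 (ler_rabs z');
      have h2 := falg_lerM e'0 (ler_rabs z).
    by apply: (riesz_le_by2 h1 h2); ring: ez.
  have h1 := falg_lerM e0 (lerN_rabs z');
    have h2 := falg_lerM e'0 (lerN_rabs z).
  by apply: (riesz_le_by2 h1 h2); ring: ez.
by apply: (riesz_le_by1 (falg_lerM e0 h)); ring: ee.
Qed.

Lemma idempotent_rabs e z z' : idempotents e -> e * z = e * z' ->
  e * rabs z = e * rabs z'.
Proof. by move=> ie ez; apply/le_anti; rewrite !idempotent_rabs_le. Qed.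

(** Twice the difference of the two sides is a sum of two products of
positive elements such as [rabs z - z] and [rabs z' + z']. *)
Lemma ler_rabsM z z' : rabs (z * z') <= rabs z * rabs z'.
Proof.
have pos (x : X) : 0 <= rabs x + x by rewrite -[x in _ + x]opprK riesz_subr_ge0
  lerN_rabs.
have neg (x : X) : 0 <= rabs x - x by rewrite riesz_subr_ge0 ler_rabs.
have h1 := falg_mulr_ge0 (neg z) (pos z').
have h2 := falg_mulr_ge0 (pos z) (neg z').
have h3 := falg_mulr_ge0 (neg z) (neg z').
have h4 := falg_mulr_ge0 (pos z) (pos z').
rewrite rabs_ler; apply/andP; split; rewrite -riesz_subr_ge0;
  apply: riesz_ge0_of_double.
  by apply: (riesz_le_by2 h1 h2); ring.
by apply: (riesz_le_by2 h3 h4); ring.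
Qed.

(** * Partitions of unity *)

(** Inequalities can be checked on the pieces of a countable partition of
unity.  Off the first [n] pieces the excess is at most [(1 - s n) * (x - y)^+],
which decreases to 0 by order continuity of the multiplication. *)
Lemma partition_le (w : nat -> X) (x y : X) : localisable X ->
  countable_partition 1 w -> (forall n, w n * x <= w n * y) -> x <= y.
Proof.
move=> [_ [_ mulX] _] [iw dw [_ supw]] wxy.
have w0 n : 0 <= w n by exact: idempotent_ge0.
have ww n m : n <> m -> w n * w m = 0.
  by move=> nm; apply: idempotent_mul0 => //; apply: dw.
pose s n : X := \sum_(0 <= i < n) w i.
have sS n : s n.+1 = s n + w n by rewrite /s big_nat_recr.
have sw n m : (n <= m)%N -> s n * w m = 0.
  move=> nm; rewrite /s big_distrl big_nat big1// => i /andP[_ im].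
  by apply: ww => im'; move: (leq_trans im nm); rewrite im' ltnn.
have sI n : idempotents (s n).
  elim: n => [|n IH]; first by rewrite /s big_geq// /idempotents/= mul0r.
  rewrite sS /idempotents/=.
  ring: (IH : s n * s n = s n) (iw n : w n * w n = w n) (sw n n (leqnn n)).
pose c n : X := 1 - s n.
have c0 n : 0 <= c n by apply/idempotent_ge0/idempotentC.
have cni : nonincreasing_seq c.
  apply/nonincreasing_seqP => n.
  by apply: (riesz_le_by1 (w0 n)); rewrite /c sS; ring.
have cinf : infimums (range c) 0.
  split; first by move=> _ [n _ <-].
  move=> b bc; suff h : (1 : X) <= (1 - b : X) by apply: (riesz_le_by1 h); ring.
  apply: supw => _ [n _ <-].
  have h1 : b <= c n.+1 by apply: bc; exists n.+1.
  have h2 : 0 <= s n by exact: idempotent_ge0.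
  by apply: (riesz_le_by2 h1 h2); rewrite /c sS; ring.
pose t := rjoin (x - y) 0.
have [_ glb] : infimums (range (fun n => c n * t)) (0 * t).
  apply: (mulX c (fun=> t)) => //; first by move=> n; exact: rjoin_ger0.
  by split=> [_ [n _ <-]|b]//; apply; exists 0%N.
have : x - y <= 0 * t.
  apply: glb => _ [n _ <-].
  have h1 : s n * x <= s n * y.
    by rewrite /s !big_distrl; apply: riesz_le_sum => i; exact: wxy.
  have h2 : c n * (x - y) <= c n * t by apply: falg_lerM (rjoin_ge _).
  by apply: (riesz_le_by2 h1 h2); rewrite /c; ring.
by move=> h; apply: (riesz_le_by1 h); ring.
Qed.

(** A converse of [partition_le]: being able to test [1 <= b] piecewise
replaces the supremum condition. *)
Lemma partition_mk (w : nat -> X) : (forall n, idempotents (w n)) ->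
  (forall n m, n <> m -> w n * w m = 0) ->
  (forall b : X, (forall n, w n * (1 : X) <= w n * b) -> (1 : X) <= b) ->
  countable_partition 1 w.
Proof.
move=> iw ww sup1; split => //.
  by move=> n m nm; apply: idempotent_disjoint => //; apply: ww.
split; first by move=> _ [n _ <-]; exact: idempotent_le1.
move=> b bw; apply: sup1 => n.
have h : w n <= b by apply: bw; exists n.
have := falg_lerM (idempotent_ge0 (iw n)) h.
by rewrite (iw n : _ * _ = _) mulr1.
Qed.

Lemma finite_partition_countable m (e : 'I_m -> X) : finite_partition 1 e ->
  countable_partition 1 (fun n => if insub n is Some i then e i else 0).
Proof.
move=> [ie de e1]; apply: partition_mk.
- move=> n; case: insub => [i|]; first exact: ie.
  by rewrite /idempotents/= mul0r.
- move=> n k nk; case: insubP => [i _ ni|_]; last by rewrite mul0r.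
  case: insubP => [j _ kj|_]; last by rewrite mulr0.
  by apply: idempotent_mul0 => //; apply: de => ij; apply: nk;
    rewrite -ni -kj ij.
- move=> b h;
  have eE (x : X) : x = \sum_i e i * x by rewrite -mulr_suml e1 mul1r.
  rewrite (eE b) (eE 1).
  by apply: riesz_le_sum => i; have := h (val i); rewrite valK.
Qed.

(** Refining each piece [w n] of a partition by its own partition [v n]; the
bijection [f] enumerates the pairs of indices. *)
Lemma partition_mul (w : nat -> X) (v : nat -> nat -> X)
    (f : nat -> nat * nat) (g : nat * nat -> nat) :
  localisable X -> cancel f g -> cancel g f ->
  countable_partition 1 w -> (forall n, countable_partition 1 (v n)) ->
  countable_partition 1 (fun k => w (f k).1 * v (f k).1 (f k).2).
Proof.
move=> locX fg gf pw pv.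
have [iw dw _] := pw.
have iv n m : idempotents (v n m) by have [] := pv n.
apply: partition_mk.
- move=> k; rewrite /idempotents/=.
  ring: (iw (f k).1 : _ * _ = _) (iv (f k).1 (f k).2 : _ * _ = _).
- move=> k l kl.
  have : f k <> f l by move=> /(can_inj fg).
  case: (f k) (f l) => [a b] [a' b'] /= ab.
  have [aa|/eqP aa] := eqVneq a a'; last first.
    by have h := idempotent_mul0 (iw a) (iw a') (dw _ _ aa); ring: h.
  have bb : b <> b' by move=> bb; apply: ab; rewrite aa bb.
  rewrite -aa.
  have [_ dv _] := pv a.
  by have h := idempotent_mul0 (iv a b) (iv a b') (dv _ _ bb); ring: h.
- move=> b h; apply: (partition_le locX pw) => n.
  apply: (partition_le locX (pv n)) => m.
  have := h (g (n, m)); rewrite gf /= => {}h.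
  by apply: (riesz_le_by1 h); ring.
Qed.

End FAlg.

Lemma nat2_enum : exists (f : nat -> nat * nat) (g : nat * nat -> nat),
  cancel f g /\ cancel g f.
Proof.
have /card_set_bijP[g [_ ginj gsurj]] := card_nat2.
have gs n : exists p, g p = n by have [p _ <-] := gsurj n I; exists p.
have [f gf] := choice gs.
exists f, g; split=> // p; apply: ginj; rewrite ?gf//; exact: in_setT.
Qed.

(** * The action of U on V *)

Local Notation "u ** x" := (uv_act u x) (at level 40, left associativity).

Section SubVal.
Context {R : realType} {S : metricFStructure R}.
Implicit Types (u w : elU S) (x y z a b c : elV S).

Lemma elV_valD x y : val (x + y) = val x + val y. Proof. exact: raddfD. Qed.
Lemma elV_valN x : val (- x) = - val x. Proof. exact: raddfN. Qed.
Lemma elV_val0 : val (0 : elV S) = 0. Proof. exact: raddf0. Qed.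
Lemma elV_valZ (l : R) x : val (l *: x) = fconst l * val x.
Proof. by rewrite -fscaleE; apply: linearZ. Qed.
Lemma elU_valD u w : val (u + w) = val u + val w. Proof. exact: raddfD. Qed.
Lemma elU_valN u : val (- u) = - val u. Proof. exact: raddfN. Qed.
Lemma elU_val0 : val (0 : elU S) = 0. Proof. exact: raddf0. Qed.
Lemma elU_val1 : val (1 : elU S) = 1. Proof. by []. Qed.
Lemma elU_valM u w : val (u * w) = val u * val w. Proof. by []. Qed.
Lemma elU_valZ (l : R) u : val (l *: u) = fconst l * val u.
Proof. by rewrite -fscaleE; apply: linearZ. Qed.
Lemma elU_val_fconst (l : R) : val (fconst l : elU S) = fconst l.
Proof. by rewrite [LHS]elU_valZ mulr1. Qed.
Lemma val_act u x : val (u ** x) = val u * val x. Proof. by []. Qed.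

Definition el_valE := (val_act, elV_valD, elV_valN, elV_val0, elV_valZ,
  elU_valD, elU_valN, elU_val0, elU_val1, elU_valM, elU_val_fconst, elU_valZ,
  @fconst1 R (ambient S), @fconstD R (ambient S), @fconstN R (ambient S),
  @fconstM R (ambient S)).

End SubVal.

(** Equalities in V are proved in the ambient f-algebra, which is a
commutative ring, whereas V has no multiplication of its own. *)
Ltac elV_ring := apply: val_inj; rewrite ?el_valE; ring.

Section Act.
Context {R : realType} {S : metricFStructure R}.
Implicit Types (u w : elU S) (x y z a b c : elV S).

Lemma act1 x : 1 ** x = x. Proof. elV_ring. Qed.
Lemma act0 x : 0 ** x = 0. Proof. elV_ring. Qed.
Lemma actA u w x : (u * w) ** x = u ** (w ** x). Proof. elV_ring. Qed.
Lemma actDl u w x : (u + w) ** x = u ** x + w ** x. Proof. elV_ring. Qed.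
Lemma actDr u x y : u ** (x + y) = u ** x + u ** y. Proof. elV_ring. Qed.
Lemma actBl u w x : (u - w) ** x = u ** x - w ** x. Proof. elV_ring. Qed.
Lemma act_fconst (l : R) x : fconst l ** x = l *: x. Proof. elV_ring. Qed.

Lemma act_ge0 u x : 0 <= u -> 0 <= x -> 0 <= u ** x.
Proof. by rewrite -!Order.le_val; apply: fmul_ge0. Qed.

Lemma ler_actr u x y : 0 <= u -> x <= y -> u ** x <= u ** y.
Proof. by rewrite -!Order.le_val; apply: falg_lerM. Qed.

Lemma ler_actl u w x : 0 <= x -> u <= w -> u ** x <= w ** x.
Proof.
rewrite -!Order.le_val !val_act [_ * val x]mulrC [_ * val x]mulrC.
exact: falg_lerM.
Qed.

Lemma idem_act_le u x : idempotents u -> 0 <= x -> u ** x <= x.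
Proof.
by move=> iu x0; rewrite -[leRHS]act1; apply: ler_actl => //;
  apply: idempotent_le1.
Qed.

(** * The distance of V *)

Definition vnorm x : R := distV x 0.

Lemma distV_isd : is_distance (@distV R S).
Proof. by have [_ [] ] := subV_metric S. Qed.

Lemma distV_norm x y : distV x y = vnorm (x - y).
Proof. by have [_ _ _ h _] := subV_metric S; rewrite -(h x y (- y)) subrr. Qed.

Lemma vnorm_ge0 x : 0 <= vnorm x.
Proof. by have [h _ _ _] := distV_isd; apply: h. Qed.
Lemma vnorm0 : vnorm 0 = 0. Proof. by have [_ h _ _] := distV_isd; apply/h. Qed.
Lemma vnorm_eq0 x : vnorm x = 0 -> x = 0.
Proof. by have [_ h _ _] := distV_isd; move/h. Qed.
Lemma vnormN x : vnorm (- x) = vnorm x.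
Proof.
by have [_ _ h _] := distV_isd;
  rewrite -[- x]sub0r -distV_norm h distV_norm subr0.
Qed.
Lemma vnormD x y : vnorm (x + y) <= vnorm x + vnorm y.
Proof.
have [_ _ _ h] := distV_isd.
by have := h (x + y) y 0; rewrite [distV _ y]distV_norm addrK.
Qed.
Lemma vnorm_abs x : vnorm x = vnorm (rabs x).
Proof. by have [_ _ h _ _] := subV_metric S; apply: h. Qed.

Lemma ler_vnorm x y : 0 <= x -> x <= y -> vnorm x <= vnorm y.
Proof. by have [_ _ _ _ h] := subV_metric S; apply: h. Qed.

Lemma ler_vnorm_abs x y : x <= y -> - x <= y -> vnorm x <= vnorm y.
Proof.
by move=> h1 h2; rewrite vnorm_abs; apply: ler_vnorm;
  rewrite ?rabs_ge0// rabs_ler h1.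
Qed.

Lemma vnormMn x n : vnorm (x *+ n) <= vnorm x *+ n.
Proof.
elim: n => [|n IH]; first by rewrite !mulr0n vnorm0.
by rewrite !mulrS; apply: (le_trans (vnormD _ _)); rewrite lerD2l.
Qed.

(** The positive cone of V is closed: [rjoin c 0] lies below the absolute
value of every such [a], so its norm is 0. *)
Lemma le0_of_vnorm c : (forall e, 0 < e ->
  exists2 a, vnorm a < e & c <= a) -> c <= 0.
Proof.
move=> h; suff : rjoin c 0 = 0 by move=> <-; exact: rjoin_ge.
apply: vnorm_eq0; apply/eqP; rewrite eq_le vnorm_ge0 andbT.
apply/ler_addgt0Pl => e e0; rewrite addr0.
have [a ae ca] := h _ e0.
apply: (le_trans _ (ltW ae)); rewrite (vnorm_abs a).
apply: ler_vnorm; first exact: rjoin_ger0.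
by rewrite rjoinP rabs_ge0 (le_trans ca (ler_rabs _)).
Qed.

Lemma elU_localisable : localisable (elU S).
Proof. by have [] := subU_metric S. Qed.

Lemma elV_dedekind : dedekind_sigma_complete (elV S).
Proof. by have [] := subV_metric S. Qed.

(** * Partitions of unity in U *)

Definition upart (u : nat -> elU S) := countable_partition 1 u.

Lemma upart_idem (u : nat -> elU S) n : upart u -> idempotents (u n).
Proof. by case. Qed.

Lemma upart_ge0 (u : nat -> elU S) n : upart u -> 0 <= u n.
Proof. by move=> /(@upart_idem _ n); apply: idempotent_ge0. Qed.

(** An upper bound of the pieces in the ambient algebra can be replaced by its
meet with 1, which belongs to U because U is solid. *)
Lemma upart_ambient (u : nat -> elU S) : upart u ->
  countable_partition 1 (fun n => val (u n)).
Proof.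
move=> pu; have [iu du [_ supu]] := pu; split.
- by move=> n; have /(congr1 val) := iu n.
- by move=> n m nm; have /(congr1 val) := du _ _ nm.
have iu' n : idempotents (val (u n)) by have /(congr1 val) := iu n.
split; first by move=> _ [n _ <-]; apply: idempotent_le1.
move=> b bu; set b1 := rmeet b 1.
have un n : val (u n) <= b1.
  by rewrite rmeetP idempotent_le1// andbT; apply: bu; exists n.
have b10 : 0 <= b1 by apply: le_trans (un 0%N); apply: idempotent_ge0.
have b1U : b1 \in (subU S : set (ambient S)).
  apply/mem_set; apply: (@subU_solid R S 1); first exact: fsub1.
  by rewrite !rabs_ge0_id ?falg_ler01//; apply: rmeet_ler.
have : (1 : elU S) <= SubOf b1U.
  by apply: supu => _ [n _ <-]; rewrite -Order.le_val; apply: un.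
by rewrite -Order.le_val => /le_trans; apply; apply: rmeet_lel.
Qed.

Lemma upart_le (u : nat -> elU S) x y : upart u ->
  (forall n, u n ** x <= u n ** y) -> x <= y.
Proof.
move=> /upart_ambient pu h; rewrite -Order.le_val.
by apply: (partition_le (ambient_localisable S) pu) => n;
  rewrite -!val_act Order.le_val.
Qed.

Lemma upart_eq (u : nat -> elU S) x y : upart u ->
  (forall n, u n ** x = u n ** y) -> x = y.
Proof.
by move=> pu h; apply/le_anti; rewrite !(upart_le pu)// => n; rewrite h.
Qed.

End Act.

(** * Small functions and limits along them *)

Section Small.
Context {R : realType} {S : metricFStructure R}.
Implicit Types (u w : nat -> elU S) (x y z a b c : elV S).

(** The infimum of [H] is 0 in a local and metric sense: glueing values of [H]
along a partition of unity gives elements of V of arbitrarily small norm. *)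
Definition small (I : Type) (H : I -> elV S) :=
  forall e : R, 0 < e -> exists u (i : nat -> I) a,
    [/\ upart u, vnorm a < e & forall n, u n ** H (i n) <= u n ** a].

Lemma small_inhabited (I : Type) (H : I -> elV S) : small H -> inhabited I.
Proof. by move=> /(_ 1 ltr01)[_ [i _]]; exists; apply: (i 0%N). Qed.

Lemma small_le (I J : Type) (H : I -> elV S) (H' : J -> elV S) :
  small H -> (forall i, exists j, H' j <= H i) -> small H'.
Proof.
move=> sH /choice[g gH] e /sH[u [i [a [pu ae ua]]]].
exists u, (g \o i), a; split=> // n; apply: le_trans (ua n).
exact: ler_actr (upart_ge0 n pu) (gH _).
Qed.

(** On each piece [u n] the bound [c <= H (i n)] gives [c <= a], where [a] has
small norm; then conclude by closedness of the positive cone. *)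
Lemma small_le0 (I : Type) (H : I -> elV S) c :
  small H -> (forall i, c <= H i) -> c <= 0.
Proof.
move=> sH cH; apply: le0_of_vnorm => e /sH[u [i [a [pu ae ua]]]].
exists a => //; apply: (upart_le pu) => n; apply: le_trans (ua n).
exact: ler_actr (upart_ge0 n pu) (cH _).
Qed.

Lemma upart_mul u (v : nat -> nat -> elU S) :
  upart u -> (forall n, upart (v n)) ->
  exists f : nat -> nat * nat, upart (fun k => u (f k).1 * v (f k).1 (f k).2).
Proof.
move=> pu pv; have [f [g [fg gf]]] := nat2_enum.
by exists f; apply: (partition_mul elU_localisable fg gf pu pv).
Qed.

Lemma small_add (I J : Type) (H : I -> elV S) (H' : J -> elV S) :
  small H -> small H' -> small (fun p : I * J => H p.1 + H' p.2).
Proof.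
move=> sH sH' e e0; have e2 : 0 < e / 2 by rewrite divr_gt0.
have [u [i [a [pu ae ua]]]] := sH _ e2.
have [v [j [b [pv be vb]]]] := sH' _ e2.
have [f pw] := upart_mul pu (fun=> pv).
exists (fun k => u (f k).1 * v (f k).2), (fun k => (i (f k).1, j (f k).2)).
exists (a + b).
split=> //.
  by rewrite (splitr e); apply: le_lt_trans (vnormD _ _) _; apply: ltrD.
move=> k /=; move: (f k).1 (f k).2 => n m.
have h1 := ler_actr (upart_ge0 m pv) (ua n).
have h2 := ler_actr (upart_ge0 n pu) (vb m).
by apply: (riesz_le_by2 h1 h2); elV_ring.
Qed.

Lemma small_mulrn (I : Type) (H : I -> elV S) k :
  small H -> small (fun i => H i *+ k).
Proof.
move=> sH e e0; have [|u [i [a [pu ae ua]]]] := sH (e / k.+1%:R).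
  by rewrite divr_gt0.
exists u, i, (a *+ k); split=> // [|n].
  apply: le_lt_trans (vnormMn _ _) _.
  apply: (@le_lt_trans _ _ (vnorm a *+ k.+1));
    first by rewrite ler_wpMn2l ?vnorm_ge0.
  by rewrite -[_ *+ k.+1]mulr_natr -ltr_pdivlMr.
elim: k {ae} => [|k IH]; first by rewrite !mulr0n.
by rewrite !mulrS !actDr; apply: riesz_lerD.
Qed.

Lemma small_double (I : Type) (H : I -> elV S) :
  small H -> small (fun i => H i + H i).
Proof. by move/(@small_mulrn _ _ 2). Qed.

(** The scalar distance of V is not homogeneous, so a real factor [K] is
first replaced by an integer. *)
Lemma small_le_scale (I : Type) (H : I -> elV S) (K : R) c b :
  small H -> (forall i, 0 <= H i) -> 0 <= K ->
  (forall i, c <= b + K *: H i) -> c <= b.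
Proof.
move=> sH H0 K0 cH; have KN := archi_boundP K0; set N := Num.bound K in KN.
suff h : c - b <= 0 by apply: (riesz_le_by1 h); elV_ring.
apply: (small_le0 (small_mulrn N sH)) => i; rewrite -scaler_nat.
have h : 0 <= (N%:R - K) *: H i by apply: riesz_scale_ge0 (H0 i);
  rewrite subr_ge0 ltW.
rewrite scalerBl in h.
by apply: (riesz_le_by2 (cH i) h); elV_ring.
Qed.

Lemma small_cst0 (I : Type) (i : I) : small (fun _ : I => 0 : elV S).
Proof.
move=> e e0.
have part1 : finite_partition (1 : elU S) (fun _ : 'I_1 => 1).
  split; first by move=> _; apply: mulr1.
    by move=> j k; rewrite !ord1.
  by rewrite big_ord1.
have p1 := finite_partition_countable part1.
by eexists; exists (fun=> i), 0; split; [exact: p1|rewrite vnorm0|move=> n].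
Qed.

(** Countably many pieces for each of the precisions [1 / (k + 1)] suffice. *)
Lemma small_countable (I : Type) (H : I -> elV S) :
  small H -> exists s : nat -> I, small (H \o s).
Proof.
move=> sH.
have /choice[i iP] : forall k, exists i : nat -> I, exists u a,
    [/\ upart u, vnorm a < k.+1%:R^-1 & forall n, u n ** H (i n) <= u n ** a].
  by move=> k; have [|u [i [a h]]] := sH k.+1%:R^-1; [|exists i, u, a].
have [f [g [_ gf]]] := nat2_enum.
exists (fun m => i (f m).1 (f m).2) => e e0.
have [k ke] : exists k : nat, k.+1%:R^-1 < e.
  have [N _ h] := near_infty_natSinv_lt (PosNum e0).
  by exists N; apply: h => /=.
have [u [a [pu ak ua]]] := iP k.
exists u, (fun n => g (k, n)), a; split=> // [|n /=]; first exact: lt_trans ke.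
by rewrite gf.
Qed.

(** A limit along errors tending to 0: if the values [F i] differ pairwise by
at most the sum of their errors, they have a common approximation [p], namely
the infimum of [F + H] over a countable set of indices where [H] is still small. *)
Lemma small_squeeze (I : Type) (F H : I -> elV S) : small H ->
  (forall i j, F i <= F j + H i + H j) ->
  exists p, forall i, F i <= p + H i /\ p <= F i + H i.
Proof.
move=> sH FH; have [s sHs] := small_countable sH.
have [_ infV] := @elV_dedekind R S.
have [||| p [lbp glbp]] := infV (range (fun n => F (s n) + H (s n))).
- exact: card_image_le.
- by exists (F (s 0%N) + H (s 0%N)), 0%N.
- have [i0] := small_inhabited sH.
  exists (F i0 - H i0) => _ [n _ <-].
  by apply: (riesz_le_by1 (FH i0 (s n))); elV_ring.
exists p => i; split.
  suff h : F i - H i <= p by apply: (riesz_le_by1 h); elV_ring.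
  apply: glbp => _ [n _ <-].
  by apply: (riesz_le_by1 (FH i (s n))); elV_ring.
suff h : p - F i - H i <= 0 by apply: (riesz_le_by1 h); elV_ring.
apply: (small_le0 (small_double sHs)) => n /=.
have h : p <= F (s n) + H (s n) by apply: lbp; exists n.
by apply: (riesz_le_by2 h (FH (s n) i)); elV_ring.
Qed.

(** A simple element [s] close to [u] takes the constant value [r n] on the
piece [w n], where therefore [u - fconst (r n)] and [u - s] agree.  The common
bound [K] of the [r n] is what makes [small_scale] work. *)
Lemma simple_approx (u : elU S) y (e : R) : 0 <= y -> 0 < e ->
  exists (w : nat -> elU S) (r : nat -> R) (K : nat) b,
  [/\ upart w, vnorm b < e, forall n, `|r n| <= K%:R &
      forall n, w n ** (rabs (u - fconst (r n)) ** y) <= w n ** b].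
Proof.
move=> y0 e0.
have [_ [_ [[_ _ dsym _] _] dabs dtr _] _ dense _] := subU_metric S.
have [dl dl0 cont] := @mulUV_continuous R S 0 y e e0.
have [s [m [l [v [[iv dv v1] ->]]]] us] := dense u dl dl0.
set s' := \sum_(i < m) _ in us.
exists (fun n => if insub n is Some i then v i else 0).
exists (fun n => if insub n is Some i then l i else 0).
have [K Kl] : exists K : nat, \sum_(i < m) `|l i| <= K%:R.
  by exists (Num.bound (\sum_(i < m) `|l i|)); apply/ltW/archi_boundP/sumr_ge0.
exists K, (rabs (u - s') ** y); split.
- exact: finite_partition_countable.
- have : distV (uv_act 0 y) (uv_act (rabs (u - s')) y) < e.
    apply: cont; rewrite distV_norm subrr vnorm0 addr0.
    by rewrite dsym -dabs -(dtr _ _ s') subrK add0r.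
  by rewrite distV_norm act0 sub0r vnormN.
- move=> n; case: insub => [i|]; last by rewrite normr0.
  apply: le_trans Kl; rewrite (bigD1 i)//= lerDl.
  by apply: sumr_ge0.
- move=> n; case: insub => [i|]; last by rewrite !act0.
  rewrite -!actA (@idempotent_rabs _ _ _ _ (u - s'))//.
  rewrite !mulrBr; congr (_ - _).
  rewrite /s' mulr_sumr (bigD1 i)//= big1 => [|j ji].
    by rewrite addr0 fscaleE mulrCA (iv i : v i * v i = v i) mulrC.
  rewrite fscaleE mulrCA (idempotent_mul0 (iv i) (iv j)) ?mulr0//.
  by apply: dv => ij; rewrite ij eqxx in ji.
Qed.

(** This is the error made in replacing [u *: x] by [r *: T v], where [y] is the
norm of [x] and [H v] its distance to [T v].  The scalar [r] is bounded along the
approximation of [u], so the second term stays small. *)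
Lemma small_scale (I : Type) (H : I -> elV S) (u : elU S) y :
  0 <= y -> (forall i, 0 <= H i) -> small H ->
  small (fun p : R * I => rabs (u - fconst p.1) ** y + `|p.1| *: H p.2).
Proof.
move=> y0 H0 sH e e0; have e2 : 0 < e / 2 by rewrite divr_gt0.
have [w [r [K [b [pw be rK wb]]]]] := simple_approx u y0 e2.
have [|v [i [a [pv ae va]]]] := sH (e / 2 / K.+1%:R); first by rewrite divr_gt0.
have [f pwv] := upart_mul pw (fun=> pv).
exists (fun k => w (f k).1 * v (f k).2), (fun k => (r (f k).1, i (f k).2)).
exists (b + a *+ K.+1).
split=> //.
  rewrite (splitr e); apply: le_lt_trans (vnormD _ _) _; apply: ltrD => //.
  apply: le_lt_trans (vnormMn _ _) _.
  by rewrite -[_ *+ K.+1]mulr_natr -ltr_pdivlMr.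
move=> k /=; move: (f k).1 (f k).2 => n m.
have h1 := ler_actr (upart_ge0 m pv) (wb n).
have h2 : `|r n| *: (v m ** H (i m)) <= K.+1%:R *: (v m ** a).
  apply: (@le_trans _ _ (K.+1%:R *: (v m ** H (i m)))).
    rewrite -riesz_subr_ge0 -scalerBl; apply: riesz_scale_ge0.
      by rewrite subr_ge0 (le_trans (rK n))// ler_nat.
    exact: act_ge0 (upart_ge0 m pv) (H0 _).
  by apply: riesz_scale_le.
have h3 := ler_actr (upart_ge0 n pw) h2.
rewrite -scaler_nat.
by apply: (riesz_le_by2 h1 h3); elV_ring.
Qed.

Lemma small_scalar (u : elU S) y :
  0 <= y -> small (fun r : R => rabs (u - fconst r) ** y).
Proof.
move=> y0.
apply: (small_le (small_scale u y0 (fun=> lexx 0) (small_cst0 tt))) => -[r t].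
by exists r; rewrite scaler0 addr0.
Qed.

End Small.

(** The real vector space M with the seminorm phi |v|, from which alone the
pushforward is built. *)
(** * Seminormed spaces and Katetov functions *)

Record seminormed (R : realType) (S : metricFStructure R) := Seminormed {
  semi_space :> lmodType R;
  semi : semi_space -> elV S;
  semiD : forall v w, semi (v + w) <= semi v + semi w;
  semiZ : forall (l : R) v, semi (l *: v) = `|l| *: semi v }.

Section Seminorm.
Context {R : realType} {S : metricFStructure R} {Q : seminormed S}.
Implicit Types v w z : Q.

Lemma semi0 : semi (0 : Q) = 0.
Proof. by have := semiZ 0 (0 : Q); rewrite scaler0 normr0 scale0r. Qed.
Lemma semiN v : semi (- v) = semi v.
Proof. by rewrite -scaleN1r semiZ normrN1 scale1r. Qed.
Lemma semiC v w : semi (v - w) = semi (w - v).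
Proof. by rewrite -semiN opprB. Qed.
Lemma semiB v w : semi (v - w) <= semi v + semi w.
Proof. by apply: le_trans (semiD _ _) _; rewrite semiN. Qed.
Lemma semi_tri z v w : semi (v - w) <= semi (v - z) + semi (z - w).
Proof. by apply: le_trans (semiD _ _); rewrite addrA subrK. Qed.
Lemma semi_ge0 v : 0 <= semi v.
Proof.
by apply: riesz_ge0_of_double; have := semiB v v; rewrite subrr semi0.
Qed.
End Seminorm.

(** A point of the module to be built, represented by the function sending [v]
to its V-valued distance to the image of [v]. *)
Record katetov (R : realType) (S : metricFStructure R) (Q : seminormed S) :=
Katetov {
  kfun :> Q -> elV S;
  kfun_le : forall v w, kfun v <= kfun w + semi (v - w);
  kfun_ge : forall v w, semi (v - w) <= kfun v + kfun w;
  kfun_small : small kfun }.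

HB.instance Definition _ (R : realType) (S : metricFStructure R)
  (Q : seminormed S) := gen_eqMixin (katetov Q).
HB.instance Definition _ (R : realType) (S : metricFStructure R)
  (Q : seminormed S) := gen_choiceMixin (katetov Q).

Section Katetov.
Context {R : realType} {S : metricFStructure R} {Q : seminormed S}.
Implicit Types (f g h : katetov Q) (v w z : Q) (u : elU S).

Lemma kfun_ge0 f v : 0 <= f v.
Proof.
by apply: riesz_ge0_of_double; have := kfun_ge f v v; rewrite subrr semi0.
Qed.

Lemma katetov_ext f g : (forall v, f v = g v) -> f = g.
Proof.
case: f g => [f f1 f2 f3] [g g1 g2 g3] /= /funext fg; subst g.
by congr Katetov; exact: Prop_irrelevance.
Qed.

(** [f w + g w] bounds the distance between the points [f] and [g], and by
the hypothesis nothing positive lies below all these bounds. *)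
Lemma katetov_eq f g : (forall c, (forall w, c <= f w + g w) -> c <= 0) ->
  f = g.
Proof.
move=> fg; apply: katetov_ext => v; apply/le_anti/andP; split.
  suff h : f v - g v <= 0 by apply: (riesz_le_by1 h); elV_ring.
  apply: fg => w; have h1 := kfun_le f v w; have h2 := kfun_ge g v w.
  by apply: (riesz_le_by2 h1 h2); elV_ring.
suff h : g v - f v <= 0 by apply: (riesz_le_by1 h); elV_ring.
apply: fg => w; have h1 := kfun_le g v w; have h2 := kfun_ge f v w.
by apply: (riesz_le_by2 h1 h2); elV_ring.
Qed.

Lemma katetov_eq_small (I : Type) (H : I -> elV S) f g : small H ->
  (forall i, exists w, f w + g w <= H i + H i) -> f = g.
Proof.
move=> sH fg; apply: katetov_eq => c cfg.
apply: (small_le0 (small_double sH)) => i.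
by have [w fgw] := fg i; apply: le_trans (cfg w) fgw.
Qed.

(** The limit of the points [p i] with errors [H i]: its distance to [v] is the
limit of [semi (p i - v)] given by [small_squeeze]. *)
Lemma katetov_build (I : Type) (H : I -> elV S) (p : I -> Q) : small H ->
  (forall i j, semi (p i - p j) <= H i + H j) ->
  exists f : katetov Q, forall i, f (p i) <= H i.
Proof.
move=> sH pH.
have /choice[f fP] : forall v, exists y, forall i,
    semi (p i - v) <= y + H i /\ y <= semi (p i - v) + H i.
  move=> v; apply: (small_squeeze (F := fun i => semi (p i - v))) => // i j /=.
  have h := semi_tri (p j) (p i) v.
  by apply: (riesz_le_by2 h (pH i j)); elV_ring.
have f1 v w : f v <= f w + semi (v - w).
  suff h : f v - f w - semi (v - w) <= 0 by apply: (riesz_le_by1 h); elV_ring.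
  apply: (small_le0 (small_double sH)) => i.
  have [_ h1] := fP v i; have [h2 _] := fP w i.
  have h3 := semi_tri w (p i) v; rewrite (semiC w v) in h3.
  by apply: (riesz_le_by3 h1 h2 h3); elV_ring.
have f2 v w : semi (v - w) <= f v + f w.
  suff h : semi (v - w) - f v - f w <= 0 by apply: (riesz_le_by1 h); elV_ring.
  apply: (small_le0 (small_double sH)) => i.
  have [h1 _] := fP v i; have [h2 _] := fP w i.
  have h3 := semi_tri (p i) v w; rewrite (semiC v (p i)) in h3.
  by apply: (riesz_le_by3 h1 h2 h3); elV_ring.
have fH i : f (p i) <= H i.
  by have [_] := fP (p i) i; rewrite subrr semi0 add0r.
have sf : small f by apply: (small_le sH) => i; exists (p i).
by exists (Katetov f1 f2 sf).
Qed.

(** Here and below, an operation is introduced by the one inequality that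
[katetov_build] provides, which determines it by [katetov_eq]. *)
Lemma kembed_ex v : exists f : katetov Q, f v <= 0.
Proof.
have [|f fP] := katetov_build (p := fun=> v) (small_cst0 tt) _.
  by move=> _ _; rewrite subrr semi0 addr0.
by exists f; apply: fP tt.
Qed.
Definition kembed v : katetov Q := projT1 (cid (kembed_ex v)).
Lemma kembed_le v : kembed v v <= 0.
Proof. by rewrite /kembed; case: cid. Qed.

Lemma kembedE v w : kembed v w = semi (v - w).
Proof.
apply/le_anti/andP; split.
  have h := kfun_le (kembed v) w v; rewrite (semiC w v) in h.
  by apply: (riesz_le_by2 h (kembed_le v)); elV_ring.
have h := kfun_ge (kembed v) v w.
by apply: (riesz_le_by2 h (kembed_le v)); elV_ring.
Qed.

Lemma kadd_ex f g : exists h : katetov Q, forall v w, h (v + w) <= f v + g w.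
Proof.
have sH := small_add (kfun_small f) (kfun_small g).
have [|h hP] := katetov_build (p := fun vw : Q * Q => vw.1 + vw.2) sH.
  move=> [v w] [v' w'] /=; rewrite opprD addrACA.
  have h1 := semiD (v - v') (w - w').
  by apply: (riesz_le_by3 h1 (kfun_ge f v v') (kfun_ge g w w')); elV_ring.
by exists h => v w; apply: hP (v, w).
Qed.
Definition kadd f g : katetov Q := projT1 (cid (kadd_ex f g)).
Lemma kaddP f g v w : kadd f g (v + w) <= f v + g w.
Proof. by rewrite /kadd; case: cid. Qed.

Lemma kopp_ex f : exists h : katetov Q, forall v, h (- v) <= f v.
Proof.
apply: (katetov_build (p := fun v : Q => - v) (kfun_small f)) => v w.
by rewrite -opprD semiN; apply: kfun_ge.
Qed.
Definition kopp f : katetov Q := projT1 (cid (kopp_ex f)).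
Lemma koppP f v : kopp f (- v) <= f v.
Proof. by rewrite /kopp; case: cid. Qed.

(** The distance from [r *: v] to [u *: f] is at most this. *)
Definition kerr u f (r : R) v : elV S :=
  rabs (u - fconst r) ** f 0 + `|r| *: f v.

Lemma small_kerr u f : small (fun rv : R * Q => kerr u f rv.1 rv.2).
Proof. exact: small_scale (kfun_ge0 f 0) (kfun_ge0 f) (kfun_small f). Qed.

(** The points [r *: v] and [s *: w] are compared through a third point [z]
close to [f]; the resulting error is a real multiple of [f z], which is removed
by [small_le_scale]. *)
Lemma kscale_ex u f :
  exists h : katetov Q, forall r v, h (r *: v) <= kerr u f r v.
Proof.
have [|h hP] :=
  katetov_build (p := fun rv : R * Q => rv.1 *: rv.2) (small_kerr u f).
  move=> [r v] [s w] /=.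
  pose K := `|r| + `|r - s| + `|s|.
  apply: (small_le_scale (K := K) (kfun_small f) (kfun_ge0 f)).
    by rewrite !addr_ge0.
  move=> z.
  have h1 : semi (r *: v - s *: w) <=
      `|r| *: semi (v - z) + `|r - s| *: semi z + `|s| *: semi (z - w).
    have -> : r *: v - s *: w = r *: (v - z) + (r - s) *: z + s *: (z - w).
      rewrite !scalerBr scalerBl !addrA subrK.
      by rewrite -[r *: v - _ + _]addrA addNr addr0.
    rewrite -!semiZ; apply: le_trans (semiD _ _) _; apply: riesz_leD.
    exact: semiD.
  have h2 := riesz_scale_le (normr_ge0 r) (kfun_ge f v z).
  have h3 := riesz_scale_le (normr_ge0 s) (kfun_ge f z w).
  have h4 : `|r - s| *: semi z <= `|r - s| *: (f z + f 0).
    by apply: riesz_scale_le => //; have := kfun_ge f z 0; rewrite subr0.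
  have h5 : `|r - s| *: f 0 <= rabs (u - fconst r) ** f 0
      + rabs (u - fconst s) ** f 0.
    rewrite -actDl -(act_fconst `|r - s|); apply: ler_actl (kfun_ge0 _ _) _.
    rewrite -rabs_fconst.
    have -> : fconst (r - s) = (u - fconst s) - (u - fconst r) :> elU S.
      by rewrite fconstD fconstN; ring.
    by rewrite addrC -(rabsN (u - fconst r)); apply: rabsD.
  rewrite /kerr /K !scalerDl.
  by apply: (riesz_le_by3 h1 (riesz_lerD h2 h3) (riesz_lerD h4 h5)); elV_ring.
by exists h => r v; apply: hP (r, v).
Qed.
Definition kscale u f : katetov Q := projT1 (cid (kscale_ex u f)).
Lemma kscaleP u f r v : kscale u f (r *: v) <= kerr u f r v.
Proof. by rewrite /kscale; case: cid. Qed.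

Lemma kaddA : associative kadd.
Proof.
move=> f g h.
have sgh := small_add (kfun_small g) (kfun_small h).
apply: (katetov_eq_small (small_add (kfun_small f) sgh)).
move=> [v [w z]] /=; exists (v + (w + z)).
have h1 := kaddP f (kadd g h) v (w + z); have h2 := kaddP g h w z.
have h3 := kaddP (kadd f g) h (v + w) z; have h4 := kaddP f g v w.
rewrite -addrA in h3.
by apply: (riesz_le_by2 (riesz_lerD h1 h2) (riesz_lerD h3 h4)); elV_ring.
Qed.

Lemma kaddC : commutative kadd.
Proof.
move=> f g; apply: (katetov_eq_small (small_add (kfun_small f) (kfun_small g))).
move=> [v w] /=; exists (v + w).
have h1 := kaddP f g v w; have h2 := kaddP g f w v; rewrite addrC in h2.
by apply: (riesz_le_by2 h1 h2); elV_ring.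
Qed.

Lemma kadd0 : left_id (kembed 0) kadd.
Proof.
move=> f; apply: (katetov_eq_small (kfun_small f)) => v; exists v.
have h1 := kaddP (kembed 0) f 0 v; rewrite add0r in h1.
by apply: (riesz_le_by2 h1 (kembed_le 0)); elV_ring.
Qed.

Lemma kaddN : left_inverse (kembed 0) kopp kadd.
Proof.
move=> f; apply: (katetov_eq_small (kfun_small f)) => v; exists 0.
have h1 := kaddP (kopp f) f (- v) v; rewrite addNr in h1.
by apply: (riesz_le_by3 h1 (koppP f v) (kembed_le 0)); elV_ring.
Qed.

HB.instance Definition _ := GRing.isZmodule.Build (katetov Q) kaddA kaddC kadd0
  kaddN.

Lemma kaddE f g : f + g = kadd f g. Proof. by []. Qed.

Lemma kscale1 : left_id 1 kscale.
Proof.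
move=> f; apply: (katetov_eq_small (kfun_small f)) => v; exists v.
have := kscaleP 1 f 1 v;
  rewrite scale1r /kerr fconst1 subrr (rabs_ge0_id (lexx 0)).
by rewrite act0 add0r normr1 scale1r => h; apply: (riesz_le_by1 h); elV_ring.
Qed.

Lemma kscaleA (u w : elU S) f : kscale u (kscale w f) = kscale (u * w) f.
Proof.
pose y := kscale w f 0 + rabs w ** f 0.
have y0 : 0 <= y.
  by apply: riesz_addr_ge0 (kfun_ge0 _ _) (act_ge0 (rabs_ge0 w) (kfun_ge0 _ _)).
have kerr0 (p : R * Q) : 0 <= kerr w f p.1 p.2.
  apply: riesz_addr_ge0; first exact: act_ge0 (rabs_ge0 _) (kfun_ge0 _ _).
  exact: riesz_scale_ge0 (normr_ge0 _) (kfun_ge0 _ _).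
apply: (katetov_eq_small (small_scale u y0 kerr0 (small_kerr w f))).
move=> [r [s v]] /=; exists (r *: (s *: v)).
have h1 := kscaleP u (kscale w f) r (s *: v).
have h2 := riesz_scale_le (normr_ge0 r) (kscaleP w f s v).
have h3 := kscaleP (u * w) f (r * s) v; rewrite -scalerA in h3.
have h4 : rabs (u * w - fconst (r * s)) ** f 0 <=
    rabs (u - fconst r) ** (rabs w ** f 0) +
    `|r| *: (rabs (w - fconst s) ** f 0).
  rewrite -actA -act_fconst -actA -actDl -rabs_fconst.
  apply: ler_actl (kfun_ge0 _ _) _.
  have -> : u * w - fconst (r * s) = (u - fconst r) * w +
      fconst r * (w - fconst s).
    by rewrite fconstM; ring.
  by apply: le_trans (rabsD _ _) _; apply: riesz_lerD; apply: ler_rabsM.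
have h5 := act_ge0 (rabs_ge0 (u - fconst r)) y0.
rewrite /kerr /y normrM in h1 h2 h3 h5 *.
by apply: (riesz_le_by3 (riesz_lerD h1 h2) h3 (riesz_lerD h4 h5)); elV_ring.
Qed.

Lemma kscaleDr : right_distributive kscale +%R.
Proof.
move=> u f g; pose y := (f + g) 0 + (f 0 + g 0).
have y0 : 0 <= y.
  by apply: riesz_addr_ge0 (kfun_ge0 _ _) (riesz_addr_ge0 (kfun_ge0 _ _)
    (kfun_ge0 _ _)).
have H0 (p : Q * Q) : 0 <= f p.1 + g p.2.
  exact: riesz_addr_ge0 (kfun_ge0 _ _) (kfun_ge0 _ _).
have sfg := small_add (kfun_small f) (kfun_small g).
apply: (katetov_eq_small (small_scale u y0 H0 sfg)).
move=> [r [v w]] /=; exists (r *: (v + w)).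
have h1 := kscaleP u (f + g) r (v + w).
have h2 := riesz_scale_le (normr_ge0 r) (kaddP f g v w).
have h3 := kaddP (kscale u f) (kscale u g) (r *: v) (r *: w).
rewrite -scalerDr in h3.
have h4 := riesz_lerD (kscaleP u f r v) (kscaleP u g r w).
have h5 := act_ge0 (rabs_ge0 (u - fconst r)) y0.
rewrite /kerr /y in h1 h2 h3 h4 h5 *.
by apply: (riesz_le_by3 (riesz_lerD h1 h2) (riesz_lerD h3 h4) h5); elV_ring.
Qed.

(** The two sides are compared at [(r + s) *: v] with [r], [s] and [v]
independent.  The error in [v] has the unbounded coefficient
[`|r + s| + `|r| + `|s|], so [v] is eliminated first, with [r] and [s] fixed. *)
Lemma kscaleDl f : {morph kscale^~ f : u w / u + w}.
Proof.
move=> u w; apply: katetov_eq => c cP.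
pose E (p : R * R) := rabs (u - fconst p.1) ** f 0 +
  rabs (w - fconst p.2) ** f 0.
have sE : small E :=
  small_add (small_scalar u (kfun_ge0 f 0)) (small_scalar w (kfun_ge0 f 0)).
apply: (small_le0 (small_double sE)) => -[r s].
pose K := `|r + s| + `|r| + `|s|.
apply: (small_le_scale (K := K) (kfun_small f) (kfun_ge0 f)).
  by rewrite !addr_ge0.
move=> v; have h0 := cP ((r + s) *: v).
have h1 := kscaleP (u + w) f (r + s) v.
have h2 := kaddP (kscale u f) (kscale w f) (r *: v) (s *: v);
  rewrite -scalerDl in h2.
have h3 := riesz_lerD (kscaleP u f r v) (kscaleP w f s v).
have h4 : rabs (u + w - fconst (r + s)) ** f 0 <= E (r, s).
  rewrite /E -actDl; apply: ler_actl (kfun_ge0 _ _) _.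
  have -> : u + w - fconst (r + s) = (u - fconst r) + (w - fconst s).
    by rewrite fconstD; ring.
  exact: rabsD.
rewrite /kerr /E /K !scalerDl /= in h0 h1 h2 h3 h4 *.
by apply: (riesz_le_by3 (riesz_lerD h0 h1) (riesz_lerD h2 h3) h4); elV_ring.
Qed.

HB.instance Definition _ := GRing.Zmodule_isLmodule.Build (elU S) (katetov Q)
  kscaleA kscale1 kscaleDr kscaleDl.

(** * The norm of Katetov functions *)

Definition knorm f : elV S := f 0.

Lemma knorm_ge0 f : 0 <= knorm f. Proof. exact: kfun_ge0. Qed.

Lemma knorm_eq0 f : knorm f = 0 <-> f = 0.
Proof.
split=> [f0|->]; last first.
  by apply/le_anti; rewrite knorm_ge0 andbT; apply: kembed_le.
apply: (katetov_eq_small (small_cst0 tt)) => _; exists 0.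
by rewrite [f 0]f0; apply: riesz_lerD (lexx 0) (kembed_le 0).
Qed.

Lemma knormD f g : knorm (f + g) <= knorm f + knorm g.
Proof. by have := kaddP f g 0 0; rewrite addr0. Qed.

(** Both sides are within [kerr u f r v] of [`|r| *: semi v]. *)
Lemma knormZ u f : knorm (u *: f) = rabs u ** knorm f.
Proof.
have sH := small_double (small_kerr u f).
apply/le_anti; rewrite /knorm; apply/andP; split.
  suff h : (u *: f) 0 - rabs u ** f 0 <= 0 by apply: (riesz_le_by1 h); elV_ring.
  apply: (small_le0 sH) => -[r v] /=.
  have h1 := kscaleP u f r v.
  have h2 := kfun_le (u *: f) 0 (r *: v); rewrite sub0r semiN semiZ in h2.
  have h3 := riesz_scale_le (normr_ge0 r) (kfun_ge f v 0); rewrite subr0 in h3.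
  have h4 : fconst `|r| ** f 0 <= (rabs (u - fconst r) + rabs u) ** f 0.
    apply: ler_actl (kfun_ge0 _ _) _; rewrite -rabs_fconst -(rabsN (u - _)).
    by apply: le_trans (rabsD _ _); rewrite opprB subrK.
  rewrite /kerr in h1 *.
  by apply: (riesz_le_by3 (riesz_lerD h1 h2) h3 h4); elV_ring.
suff h : rabs u ** f 0 - (u *: f) 0 <= 0 by apply: (riesz_le_by1 h); elV_ring.
apply: (small_le0 sH) => -[r v] /=.
have h1 := kscaleP u f r v.
have h2 := kfun_ge (u *: f) 0 (r *: v); rewrite sub0r semiN semiZ in h2.
have h3 := kfun_le f 0 v; rewrite sub0r semiN in h3.
have {}h3 := riesz_scale_le (normr_ge0 r) h3.
have h4 : rabs u ** f 0 <= (rabs (u - fconst r) + fconst `|r|) ** f 0.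
  apply: ler_actl (kfun_ge0 _ _) _; rewrite -rabs_fconst.
  by apply: le_trans (rabsD _ _); rewrite subrK.
rewrite /kerr in h1 *.
by apply: (riesz_le_by3 (riesz_lerD h1 h2) h3 h4); elV_ring.
Qed.

Lemma kdistC f g : knorm (f - g) = knorm (g - f).
Proof.
rewrite -opprB -scaleN1r knormZ rabsN rabs_ge0_id ?act1//; exact: falg_ler01.
Qed.

Lemma kdist_tri h f g : knorm (f - g) <= knorm (f - h) + knorm (h - g).
Proof. by apply: le_trans (knormD _ _); rewrite addrA subrK. Qed.

Lemma kdist_le f g w : knorm (f - g) <= f w + g w.
Proof.
have h1 := kaddP f (- g) w (- w); rewrite subrr in h1.
by apply: (riesz_le_by2 h1 (koppP g w)); elV_ring.
Qed.

(** The values of [f] are the distances that they are meant to be. *)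
Lemma kdist_embed f v : knorm (f - kembed v) = f v.
Proof.
apply/le_anti; rewrite /knorm; apply/andP; split.
  by apply: (riesz_le_by2 (kdist_le f (kembed v) v) (kembed_le v)); elV_ring.
have h1 := kaddP (f - kembed v) (kembed v) 0 v;
  rewrite add0r -kaddE subrK in h1.
by apply: (riesz_le_by2 h1 (kembed_le v)); elV_ring.
Qed.

Lemma kembed_linear (l : R) v w :
  kembed (l *: v + w) = fconst l *: kembed v + kembed w.
Proof.
apply: (katetov_eq_small (small_cst0 tt)) => _; exists (l *: v + w).
have h1 := kembed_le (l *: v + w).
have h2 := kaddP (fconst l *: kembed v) (kembed w) (l *: v) w.
have h3 := kscaleP (fconst l) (kembed v) l v.
have h4 := riesz_scale_le (normr_ge0 l) (kembed_le v).
rewrite /kerr subrr (rabs_ge0_id (lexx 0)) in h3.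
by apply: (riesz_le_by3 (riesz_lerD h1 h2) (riesz_lerD h3 h4) (kembed_le w));
  elV_ring.
Qed.

End Katetov.

(** * Glueing and completeness *)

Section Glue.
Context {R : realType} {S : metricFStructure R}.
Implicit Types (x y a b c : elV S).

Lemma cvg_to0P (x : nat -> R) : (forall n, 0 <= x n) ->
  (x n @[n --> \oo] --> (0 : R)) <->
  (forall e, 0 < e -> exists N, forall n, (N <= n)%N -> x n < e).
Proof.
move=> x0; split=> [/cvgr0Pnorm_lt xc e /xc[N _ xN]|xc].
  by exists N => n /xN; rewrite /= ger0_norm.
apply/cvgr0Pnorm_lt => e /xc[N xN]; exists N => // n /= Nn.
by rewrite ger0_norm// xN.
Qed.

(** The supremum of the [u n ** x n]; disjointness of the pieces gives its value
on each of them. *)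
Lemma vglue (u : nat -> elU S) (x : nat -> elV S) b : upart u ->
  (forall n, 0 <= x n) -> (forall n, u n ** x n <= b) ->
  exists y, forall n, u n ** y = u n ** x n.
Proof.
move=> pu x0 xb; have [supV _] := @elV_dedekind R S.
have [|||y [uby luby]] := supV (range (fun n => u n ** x n)).
- exact: card_image_le.
- by exists (u 0%N ** x 0%N), 0%N.
- by exists b => _ [n _ <-].
exists y => n.
have ux m : u m ** x m <= y by apply: uby; exists m.
have ux0 m : 0 <= u m ** x m by apply: act_ge0 (x0 m); apply: upart_ge0.
have y0 : 0 <= y := le_trans (ux0 0%N) (ux 0%N).
have iu : u n * u n = u n := upart_idem n pu.
apply/le_anti/andP; split; last first.
  by have := ler_actr (upart_ge0 n pu) (ux n); rewrite -actA iu.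
have h : y <= u n ** x n + (1 - u n) ** y.
  apply: luby => _ [m _ <-].
  have cn0 : 0 <= 1 - u n by rewrite riesz_subr_ge0 idempotent_le1//;
    apply: upart_idem.
  have cy0 := act_ge0 cn0 y0.
  have [<-|/eqP nm] := eqVneq n m; first by apply: (riesz_le_by1 cy0); elV_ring.
  have unm : u n * u m = 0.
    have [iu' du _] := pu.
    by apply: idempotent_mul0 => //; apply: du.
  have e : u m ** x m = (1 - u n) ** (u m ** x m).
    by rewrite actBl act1 -[u n ** _]actA unm act0 subr0.
  rewrite e; apply: (riesz_le_by2 (ux0 n) (ler_actr cn0 (ux m))); elV_ring.
by apply: (riesz_le_by1 h); elV_ring.
Qed.
End Glue.

Section KatetovGlue.
Context {R : realType} {S : metricFStructure R} {Q : seminormed S}.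
Implicit Types (f g h : katetov Q) (v w z : Q).

(** The function [f n] is small with precision [dl / 2 ^ (n + 1)]; these errors are
summable, and the glueing axiom of a metric f-structure turns them into a single
error [s] of small norm. *)
Lemma small_glue (u : nat -> elU S) (f : nat -> katetov Q) (H : Q -> elV S) :
  upart u -> (forall n v, u n ** H v = u n ** f n v) -> small H.
Proof.
move=> pu uH e e0; have e2 : 0 < e / 2 by rewrite divr_gt0.
have [dl dl0 glueP] := mulUV_glue pu e2.
have /choice[F FP] n : exists F : (nat -> elU S) * (nat -> Q) * elV S,
    [/\ upart F.1.1, vnorm F.2 < dl / (2 ^ n.+1)%:R &
      forall m, F.1.1 m ** f n (F.1.2 m) <= F.1.1 m ** F.2].
  have [|w [p [a [h1 h2 h3]]]] := kfun_small (f n) (e := dl / (2 ^ n.+1)%:R).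
    by rewrite divr_gt0// ltr0n expn_gt0.
  by exists (w, p, a).
have pF n : upart (F n).1.1 by have [] := FP n.
have a0 n : 0 <= (F n).2.
  apply: (upart_le (pF n)) => m; have [_ _ h] := FP n.
  by apply: le_trans (h m); apply: ler_actr (upart_ge0 m (pF n)) (kfun_ge0 _ _).
have [|_ [s [us _] se]] := glueP (fun n => (F n).2) a0.
  apply: le_trans (epsilon_trick0 xpredT (ltW dl0)).
  apply: lee_nneseries => [n _ _|n _]; first by rewrite lee_fin vnorm_ge0.
  rewrite lee_fin; have [_ h _] := FP n.
  apply: le_trans (ltW h); apply: ler_vnorm.
    exact: act_ge0 (upart_ge0 n pu) (a0 n).
  exact: idem_act_le (upart_idem n pu) (a0 n).
have [k pw] := upart_mul pu pF.
exists (fun j => u (k j).1 * (F (k j).1).1.1 (k j).2).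
exists (fun j => (F (k j).1).1.2 (k j).2), s; split=> //.
  by apply: le_lt_trans se _; rewrite gtr_pMr// invf_lt1// ltr1n.
move=> j; move: (k j).1 (k j).2 => n m.
have [_ _ /(_ m) h1] := FP n.
have h2 := ler_actr (upart_ge0 n pu) h1.
have uas : u n ** (F n).2 <= s by apply: us; exists n.
have h3 := ler_actr (upart_ge0 m (pF n)) (ler_actr (upart_ge0 n pu) uas).
have iu : u n * u n = u n := upart_idem n pu.
rewrite -(actA (u n) (u n)) iu in h3.
rewrite [u n * _]mulrC actA uH.
by apply: (riesz_le_by2 h2 h3); elV_ring.
Qed.

(** The glued point is built as the limit of all points of the space, with
the error [H v] obtained by glueing the values [f n v]. *)
Lemma katetov_glue (u : nat -> elU S) (f : nat -> katetov Q) :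
  countable_partition 1 u ->
  order_bounded (range (fun n => knorm (u n *: f n))) ->
  exists g, forall n, u n *: g = u n *: f n.
Proof.
move=> pu [_ [b ub]].
have fb n : u n ** f n 0 <= b.
  apply: ub; exists n => //; rewrite knormZ rabs_ge0_id//.
  exact: upart_ge0.
have /choice[H HP] v : exists y, forall n, u n ** y = u n ** f n v.
  apply: (vglue (b := b + semi v) pu (fun n => kfun_ge0 (f n) v)) => n.
  have h1 := ler_actr (upart_ge0 n pu) (kfun_le (f n) v 0); rewrite subr0 in h1.
  have h2 := idem_act_le (upart_idem n pu) (semi_ge0 v).
  by apply: (riesz_le_by3 h1 (fb n) h2); elV_ring.
have sH := small_glue pu (fun n v => HP v n).
have [v w|g gP] := katetov_build (p := id) sH _.
  apply: (upart_le pu) => n; rewrite actDr !HP -actDr.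
  exact: ler_actr (upart_ge0 n pu) (kfun_ge _ _ _).
exists g => n; apply/eqP; rewrite -subr_eq0 -scalerBr; apply/eqP/knorm_eq0.
apply/le_anti; rewrite knorm_ge0 andbT knormZ rabs_ge0_id;
  last exact: upart_ge0.
apply: (small_le0 (small_double (kfun_small (f n)))) => v.
have h1 := ler_actr (upart_ge0 n pu) (kdist_le g (f n) v).
have h2 := ler_actr (upart_ge0 n pu) (gP v); rewrite HP in h2.
have h3 := idem_act_le (upart_idem n pu) (kfun_ge0 (f n) v).
by apply: (riesz_le_by3 h1 h2 (riesz_lerD h3 h3)); elV_ring.
Qed.

Definition katetov_module : normedModule S :=
  Defs.NormedModule (@knorm_ge0 R S Q) knorm_eq0 knormD knormZ katetov_glue.

(** A Cauchy sequence [f] has the limit of the points [v] with error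
[f m v + b m], where [b m] is the limit over [n] of the distances from [f m] to
[f n]. *)
Lemma katetov_complete : complete_distance (@nmod_dist R S katetov_module).
Proof.
move=> f fC.
have {}fC e : 0 < e -> exists n0, forall m n, (n0 <= m)%N -> (n0 <= n)%N ->
    vnorm (knorm (f m - f n)) < e := fC e.
pose D m n : elV S := knorm (f m - f n).
have DC m n : D m n = D n m := kdistC (f m) (f n).
have Dtri m n k : D m k <= D m n + D n k := kdist_tri (f n) (f m) (f k).
have DL m n k : vnorm (D m n - D m k) <= vnorm (D n k).
  apply: ler_vnorm_abs.
    have h := Dtri m k n; rewrite (DC k n) in h.
    by apply: (riesz_le_by1 h); elV_ring.
  by apply: (riesz_le_by1 (Dtri m n k)); elV_ring.
have [_ [_ cV] _ _ _] := subV_metric S.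
have /choice[b bP] m : exists b, forall e, 0 < e -> exists N, forall n,
    (N <= n)%N -> vnorm (D m n - b) < e.
  have [|b] := cV (D m).
    move=> e /fC[N NP]; exists N => n k Nn Nk; rewrite distV_norm.
    by apply: le_lt_trans (DL m n k) (NP _ _ Nn Nk).
  move/cvg_to0P => h; exists b => e /h[|N NP].
    by move=> n; rewrite distV_norm vnorm_ge0.
  by exists N => n /NP; rewrite distV_norm.
have Db m n : D m n <= b m + b n.
  suff h : D m n - b m - b n <= 0 by apply: (riesz_le_by1 h); elV_ring.
  apply: le0_of_vnorm => e e0; have e2 : 0 < e / 2 by rewrite divr_gt0.
  have [N1 h1] := bP m _ e2; have [N2 h2] := bP n _ e2.
  pose k := maxn N1 N2.
  exists ((D m k - b m) + (D n k - b n)).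
    rewrite (splitr e); apply: le_lt_trans (vnormD _ _) _.
    by apply: ltrD; [apply: h1; apply: leq_maxl|apply: h2; apply: leq_maxr].
  have h := Dtri m k n; rewrite (DC k n) in h.
  by apply: (riesz_le_by1 h); elV_ring.
have b0 e : 0 < e -> exists N, forall m, (N <= m)%N -> vnorm (b m) < e.
  move=> e0; have e2 : 0 < e / 2 by rewrite divr_gt0.
  have [N NP] := fC _ e2; exists N => m Nm.
  have [N1 h1] := bP m _ e2; pose k := maxn N N1.
  have -> : b m = D m k - (D m k - b m) by elV_ring.
  rewrite (splitr e); apply: le_lt_trans (vnormD _ _) _; rewrite vnormN.
  by apply: ltrD; [apply: NP => //; apply: leq_maxl|apply: h1; apply: leq_maxr].
(* An index is a pair of a point and of a term of the sequence. *)
pose H (p : Q * nat) := f p.2 p.1 + b p.2.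
have sH : small H.
  move=> e e0; have e2 : 0 < e / 2 by rewrite divr_gt0.
  have [N NP] := b0 _ e2.
  have [u [i [a [pu ae ua]]]] := kfun_small (f N) e2.
  exists u, (fun n => (i n, N)), (a + b N); split=> //.
    rewrite (splitr e); apply: le_lt_trans (vnormD _ _) _.
    by apply: ltrD => //; apply: NP.
  by move=> n; rewrite /H !actDr; apply: riesz_leD.
have [[v m] [w n] /=|g gP] := katetov_build (p := fun p : Q * nat => p.1) sH _.
  have h1 := kfun_ge (f m) v w.
  have h2 : f m w <= f n w + D m n.
    have := kaddP (f m - f n) (f n) 0 w; rewrite -kaddE subrK add0r => h.
    by apply: (riesz_le_by1 h); rewrite /D /knorm; elV_ring.
  by rewrite /H; apply: (riesz_le_by3 h1 h2 (Db m n)) => /=; elV_ring.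
exists g; apply/cvg_to0P => [n|e e0]; first exact: vnorm_ge0.
have [N NP] := b0 _ e0; exists N => n /NP; apply: le_lt_trans.
apply: ler_vnorm; first exact: knorm_ge0.
suff h : knorm (f n - g) - b n <= 0 by apply: (riesz_le_by1 h); elV_ring.
apply: (small_le0 (small_double (kfun_small (f n)))) => v.
have h1 := gP (v, n); rewrite /H /= in h1.
by apply: (riesz_le_by2 (kdist_le (f n) g v) h1); elV_ring.
Qed.

Definition katetov_banach : banachModule S := BanachModule katetov_complete.

(** This is smallness of [f] read back: its points [v n] and pieces [u n]
glue to an element at distance at most [a]. *)
Lemma kembed_dense :
  dense_for (@nmod_dist R S katetov_module) (glued (range (@kembed R S Q : Q ->
    katetov_module))).
Proof.
move=> f e e0; have [u [v [a [pu ae ua]]]] := kfun_small f e0.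
have a0 : 0 <= a.
  apply: (upart_le pu) => n; apply: le_trans (ua n).
  exact: ler_actr (upart_ge0 n pu) (kfun_ge0 _ _).
have ab : order_bounded (range (fun n => knorm (u n *: kembed (v n)))).
  split; first by exists 0 => _ [n _ <-]; apply: knorm_ge0.
  exists (a + f 0) => _ [n _ <-]; rewrite knormZ rabs_ge0_id;
    last exact: upart_ge0.
  have h1 := kfun_ge f (v n) 0; rewrite -kembedE in h1.
  have {}h1 := ler_actr (upart_ge0 n pu) h1.
  have h2 := idem_act_le (upart_idem n pu) a0.
  have h3 := idem_act_le (upart_idem n pu) (kfun_ge0 f 0).
  by apply: (riesz_le_by2 (riesz_lerD h1 (ua n)) (riesz_lerD h2 h3));
    rewrite /knorm; elV_ring.
have [g gP] := katetov_glue pu ab.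
exists g; first by exists u, (fun n => kembed (v n)); split=> // n;
  exists (v n).
apply: le_lt_trans ae; apply: ler_vnorm; first exact: knorm_ge0.
apply: (upart_le pu) => n; rewrite -[X in X ** _]rabs_ge0_id;
  last exact: upart_ge0.
rewrite -knormZ scalerBr gP -scalerBr knormZ kdist_embed rabs_ge0_id//.
exact: upart_ge0.
Qed.

End KatetovGlue.

(** * Comparison with an arbitrary solution *)

Section NormedModule.
Context {R : realType} {S : metricFStructure R} {N : normedModule S}.
Implicit Types x y z : N.

Lemma nmod_norm0 : nmod_norm (0 : N) = 0.
Proof. exact/nmod_norm_eq0. Qed.

Lemma nmod_normN x : nmod_norm (- x) = nmod_norm x.
Proof.
by rewrite -scaleN1r nmod_normZ rabsN rabs_ge0_id ?falg_ler01//; apply: act1.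
Qed.

Lemma nmod_normB x y z :
  nmod_norm (x - y) <= nmod_norm (x - z) + nmod_norm (z - y).
Proof. by apply: le_trans (nmod_ler_normD _ _); rewrite addrA subrK. Qed.

Lemma upart_normZ (u : nat -> elU S) n x : upart u ->
  nmod_norm (u n *: x) = u n ** nmod_norm x.
Proof. by move=> pu; rewrite nmod_normZ rabs_ge0_id//; apply: upart_ge0. Qed.

Lemma upart_scale_inj (u : nat -> elU S) x y : upart u ->
  (forall n, u n *: x = u n *: y) -> x = y.
Proof.
move=> pu uxy; apply/eqP; rewrite -subr_eq0; apply/eqP/nmod_norm_eq0.
apply: (upart_eq pu) => n.
rewrite -upart_normZ// scalerBr uxy subrr nmod_norm0.
by elV_ring.
Qed.

End NormedModule.

Section Comparison.
Context {R : realType} {S : metricFStructure R} {Q : seminormed S}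
  {N : normedModule S} (T : Q -> N).
Implicit Types (x y : N) (v w : Q) (u : elU S).
Context
  (T_lin : forall (l : R) v w, T (l *: v + w) = fconst l *: T v + T w)
  (T_norm : forall v, nmod_norm (T v) = semi v)
  (T_dense : dense_for (@nmod_dist R S N) (glued (range T))).

Lemma map_semi0 : T 0 = 0.
Proof. by apply/nmod_norm_eq0; rewrite T_norm semi0. Qed.
Lemma map_semiD v w : T (v + w) = T v + T w.
Proof. by rewrite -[v in LHS]scale1r T_lin fconst1 scale1r. Qed.
Lemma map_semiZ (l : R) v : T (l *: v) = fconst l *: T v.
Proof. by rewrite -[l *: v]addr0 T_lin map_semi0 addr0. Qed.
Lemma map_semiB v w : T (v - w) = T v - T w.
Proof.
by rewrite map_semiD -[- w]scaleN1r map_semiZ fconstN fconst1 scaleN1r.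
Qed.

Definition dist_to x v : elV S := nmod_norm (x - T v).

Lemma dist_to_le x v w : dist_to x v <= dist_to x w + semi (v - w).
Proof. by rewrite semiC -T_norm map_semiB; apply: nmod_normB. Qed.

Lemma dist_to_ge x v w : semi (v - w) <= dist_to x v + dist_to x w.
Proof.
by rewrite -T_norm map_semiB /dist_to -[nmod_norm (x - T v)]nmod_normN opprB;
  apply: nmod_normB.
Qed.

(** Smallness is density of the glued elements: if [y] is glued from the values
[T (v n)] along [u], then [x] is as far from [T (v n)] on the piece [u n] as it
is from [y]. *)
Lemma dist_to_small x : small (dist_to x).
Proof.
move=> e e0; have [y [u [z [[pu _] zT uy]]] xy] := T_dense x e0.
have /choice[v Tv] n : exists v, T v = z n by have [v _ <-] := zT n; exists v.
exists u, v, (nmod_norm (x - y)); split=> // n.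
by rewrite -!upart_normZ// Tv !scalerBr uy.
Qed.

Definition katetov_of x : katetov Q :=
  Katetov (dist_to_le x) (dist_to_ge x) (dist_to_small x).

Lemma katetov_ofE x v : katetov_of x v = nmod_norm (x - T v). Proof. by []. Qed.

Lemma katetov_of_norm x : knorm (katetov_of x) = nmod_norm x.
Proof. by rewrite /knorm katetov_ofE map_semi0 subr0. Qed.

Lemma katetov_of_map v : katetov_of (T v) = kembed v.
Proof.
by apply: katetov_ext => w; rewrite katetov_ofE -map_semiB T_norm kembedE.
Qed.

Lemma katetov_ofD x y : katetov_of (x + y) = katetov_of x + katetov_of y.
Proof.
apply: (katetov_eq_small (small_add (dist_to_small x) (dist_to_small y))).
move=> [v w] /=; exists (v + w).
apply: riesz_lerD (kaddP (katetov_of x) (katetov_of y) v w).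
by rewrite /dist_to map_semiD opprD addrACA; apply: nmod_ler_normD.
Qed.

Lemma katetov_ofZ u x : katetov_of (u *: x) = u *: katetov_of x.
Proof.
apply: (katetov_eq_small (small_kerr u (katetov_of x))).
move=> [r v] /=; exists (r *: v).
apply: riesz_lerD (kscaleP u (katetov_of x) r v).
have -> : kerr u (katetov_of x) r v = nmod_norm ((u - fconst r) *: x) +
    nmod_norm (fconst r *: (x - T v)).
  by rewrite /kerr !katetov_ofE map_semi0 subr0 !nmod_normZ rabs_fconst
    -/(uv_act _ _) act_fconst.
rewrite /dist_to map_semiZ; apply: le_trans (nmod_ler_normD _ _).
by rewrite scalerBl scalerBr addrA subrK.
Qed.

Lemma katetov_ofB x y : katetov_of (x - y) = katetov_of x - katetov_of y.
Proof. by rewrite katetov_ofD -[- y]scaleN1r katetov_ofZ scaleN1r. Qed.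

Lemma katetov_of_inj : injective katetov_of.
Proof.
move=> x y xy; apply/eqP; rewrite -subr_eq0; apply/eqP/nmod_norm_eq0.
by rewrite -katetov_of_norm katetov_ofB xy subrr; apply/knorm_eq0.
Qed.

Lemma katetov_of_glued (z : @katetov_module R S Q) :
  glued (range (@kembed R S Q : Q -> katetov_module)) z ->
    exists x, katetov_of x = z.
Proof.
move=> [u [p [[pu pb] pT uz]]].
have /choice[v Tv] n : exists v, kembed v = p n by have [v _ <-] := pT n;
  exists v.
have bd : order_bounded (range (fun n => nmod_norm (u n *: T (v n)))).
  suff <- : (fun n => nmod_norm (u n *: p n)) =
      (fun n => nmod_norm (u n *: T (v n))).
    by [].
  by apply/funext => n;
    rewrite -Tv -katetov_of_map -katetov_of_norm katetov_ofZ.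
have [x xP] := nmod_glue pu bd.
exists x; apply: (@upart_scale_inj _ _ (@katetov_module R S Q) u) => // n.
by rewrite uz -Tv -katetov_of_map -[LHS]katetov_ofZ xP katetov_ofZ.
Qed.

Context (N_complete : complete_distance (@nmod_dist R S N)).

(** The image contains the glued elements, hence is dense; as the map
preserves distances, completeness of [N] makes it everything. *)
Lemma katetov_of_surj (f : katetov Q) : exists x, katetov_of x = f.
Proof.
have /choice[y yP] k : exists x, vnorm (knorm (f - katetov_of x)) < k.+1%:R^-1.
  have [|z /katetov_of_glued[x <-] fx] := @kembed_dense R S Q f k.+1%:R^-1;
    first by [].
  by exists x.
have inv_small e : 0 < e -> exists k, forall n, (k <= n)%N ->
  n.+1%:R^-1 < e :> R.
  move=> e0; have [k _ kP] := near_infty_natSinv_lt (PosNum e0).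
  by exists k => n /kP.
have distE a b : nmod_dist a b = vnorm (knorm (katetov_of a - katetov_of b)).
  by rewrite -katetov_ofB katetov_of_norm.
have tri (a b c : katetov Q) : vnorm (knorm (a - c)) <=
    vnorm (knorm (b - a)) + vnorm (knorm (b - c)).
  apply: le_trans (vnormD _ _); apply: ler_vnorm; first exact: knorm_ge0.
  by rewrite (kdistC b); apply: kdist_tri.
have [|x xP] := N_complete (u := y).
  move=> e e0; have e2 : 0 < e / 2 by rewrite divr_gt0.
  have [k kP] := inv_small _ e2; exists k => m n km kn; rewrite distE.
  rewrite (splitr e); apply: le_lt_trans (tri _ f _) _.
  by apply: ltrD; apply: lt_trans (yP _) (kP _ _).
exists x; apply/eqP; rewrite eq_sym -subr_eq0; apply/eqP/knorm_eq0/vnorm_eq0.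
apply/eqP; rewrite eq_le vnorm_ge0 andbT; apply/ler_addgt0Pl => e e0;
  rewrite addr0.
have e2 : 0 < e / 2 by rewrite divr_gt0.
have [k kP] := inv_small _ e2.
have d0 n : 0 <= nmod_dist (y n) x by exact: vnorm_ge0.
have [k' k'P] := (cvg_to0P d0).1 xP _ e2.
pose n := maxn k k'.
have h1 := lt_trans (yP n) (kP _ (leq_maxl k k')).
have h2 := k'P _ (leq_maxr k k' : (k' <= n)%N); rewrite distE in h2.
rewrite (splitr e); apply: le_trans (tri _ (katetov_of (y n)) _) _.
apply: lerD; last exact: ltW.
by rewrite kdistC; apply: ltW.
Qed.

End Comparison.

(** * The seminorm of the pushforward *)

Section RealForm.
Context {R : realType} {S : metricFStructure R}.

(** An alias carrying the real vector space structure given by [rscale],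
beside the module structure of [M] over U. *)
Definition real_form (M : normedModule S) : Type := M.

Context (M : normedModule S).

HB.instance Definition _ := GRing.Zmodule.on (real_form M).

Lemma rscaleA (l m : R) (v : real_form M) :
  rscale l (rscale m v : M) = rscale (l * m) (v : M).
Proof.
by rewrite /rscale scalerA; congr (_ *: _); apply: esym (fconstM l m).
Qed.
Lemma rscale1 : left_id 1 (@rscale R S M : R -> real_form M -> real_form M).
Proof. by move=> v; rewrite /rscale scale1r; apply: scale1r. Qed.
Lemma rscaleDr :
  right_distributive (@rscale R S M : R -> real_form M -> real_form M) +%R.
Proof. by move=> l v w; apply: scalerDr. Qed.
Lemma rscaleDl (v : real_form M) :
  {morph (@rscale R S M)^~ v : l m / l + m >-> (l + m : real_form M)}.
Proof. by move=> l m; rewrite /rscale scalerDl; apply: scalerDl. Qed.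

HB.instance Definition _ := GRing.Zmodule_isLmodule.Build R (real_form M)
  rscaleA rscale1 rscaleDr rscaleDl.

End RealForm.

Section PushSeminorm.
Context {R : realType} {S1 S2 : metricFStructure R} (phi : metricFHom S1 S2)
  (M : normedModule S1).

Lemma mhomV_lin (l : R) (a b : elV S1) :
  mhomV phi (l *: a + b) = l *: mhomV phi a + mhomV phi b.
Proof. by have [h _] := mhomV_riesz phi; apply: h. Qed.
Lemma mhomV0 : mhomV phi 0 = 0.
Proof.
by have /eqP := mhomV_lin 1 0 0;
  rewrite scale1r scale1r addr0 -subr_eq subrr eq_sym => /eqP.
Qed.
Lemma mhomVD a b : mhomV phi (a + b) = mhomV phi a + mhomV phi b.
Proof. by have := mhomV_lin 1 a b; rewrite !scale1r. Qed.
Lemma mhomVZ l a : mhomV phi (l *: a) = l *: mhomV phi a.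
Proof. by have := mhomV_lin l a 0; rewrite mhomV0 !addr0. Qed.

Lemma mhomV_ge0 a : 0 <= a -> 0 <= mhomV phi a.
Proof.
move=> a0; have [_ h] := mhomV_riesz phi.
have m0 : rmeet a 0 = 0 by apply/le_anti; rewrite rmeet_ler rmeetP a0 lexx.
by have := h _ _ m0; rewrite mhomV0 => <-; apply: rmeet_lel.
Qed.

Lemma mhomV_le a b : a <= b -> mhomV phi a <= mhomV phi b.
Proof.
move=> ab; have ba : 0 <= b - a by rewrite riesz_subr_ge0.
have := mhomV_ge0 ba => h; rewrite -[b in leRHS](subrK a) mhomVD.
by apply: (riesz_le_by1 h); elV_ring.
Qed.

Definition push_norm (v : real_form M) : elV S2 :=
  mhomV phi (nmod_norm (v : M)).

Lemma push_normD v w : push_norm (v + w) <= push_norm v + push_norm w.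
Proof.
by rewrite /push_norm -mhomVD; apply: mhomV_le; apply: nmod_ler_normD.
Qed.

Lemma push_normZ (l : R) v : push_norm (l *: v) = `|l| *: push_norm v.
Proof.
rewrite /push_norm -mhomVZ; congr (mhomV phi _).
by rewrite [LHS]nmod_normZ [rabs _]rabs_fconst; apply: act_fconst.
Qed.

Definition push_seminormed : seminormed S2 := Seminormed push_normD push_normZ.

End PushSeminorm.

Theorem theorem3p23 (R : realType) (S1 S2 : metricFStructure R)
    (phi : metricFHom S1 S2) (M : normedModule S1) :
  exists (N : banachModule S2) (T : M -> N),
    module_pushforward phi T /\
    forall (N' : banachModule S2) (T' : M -> N'), module_pushforward phi T' ->
      exists! Phi : N -> N', module_iso Phi /\ (forall v, Phi (T v) = T' v).
Proof.
pose Q := push_seminormed phi M.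
exists (@katetov_banach R S2 Q), (@kembed R S2 Q : M -> _); split.
  split; [|by move=> v; rewrite [LHS]kembedE subr0|exact: kembed_dense].
  by move=> l v w; apply: (@kembed_linear R S2 Q l v w).
move=> N' T' [T'lin T'norm T'dense].
pose k : N' -> katetov Q := @katetov_of R S2 Q N' T' T'lin T'norm T'dense.
have k_inj : injective k := @katetov_of_inj R S2 Q N' T' T'lin T'norm T'dense.
have kD x y : k (x + y) = k x + k y by exact: katetov_ofD.
have kZ u x : k (u *: x) = u *: k x by exact: katetov_ofZ.
have kn x : knorm (k x) = nmod_norm x by exact: katetov_of_norm.
have kT v : k (T' v) = kembed (v : Q) by exact: katetov_of_map.
have /choice[g gP] f : exists x, k x = f by apply: katetov_of_surj;
  apply: bmod_complete.
exists g; split.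
  split; last by move=> v; apply: k_inj; rewrite gP kT.
  split; last by move=> f; rewrite -kn gP.
    by move=> u f h; apply: k_inj; rewrite kD kZ !gP.
  by exists k => x; rewrite ?gP//; apply: k_inj; rewrite gP.
(* An isomorphism compatible with the two maps preserves distances to the
   image of M, so it sends f to the point with the same Katetov function. *)
move=> Psi [[Psi_lin _ Psi_norm] PsiT]; apply/funext => f.
apply: k_inj; rewrite gP; apply: katetov_ext => v.
rewrite katetov_ofE -PsiT -kdist_embed.
have -> : Psi f - Psi (kembed (v : Q)) = Psi (f - kembed (v : Q)).
  by have := Psi_lin (-1) (kembed (v : Q)) f; rewrite !scaleN1r ![- _ + _]addrC.
by rewrite Psi_norm.
Qed.
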